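(* Let $L$ be an Eulerian Sheffer poset that is also a lattice. Then either $L$ is isomorphic to $\mathbb{B}_X$, where $X$ is the set of atoms of $L$, or $L$ is isomorphic to the infinite cubical lattice $\mathbb{C}_X^{<\infty}$, where $X$ is the set of rank $2$ elements of $L$ which are greater than some fixed atom $a$ of $L$.
   Context: All posets are locally finite with a unique minimal element $\hat 0$. A Sheffer poset is such a poset $P$ that (i) contains an infinite chain, (ii) has every interval graded (rank function $\rho$, $\rho(\hat0)=0$; $[x,y]$ is an $n$-interval if $\rho(y)-\rho(x)=n$), (iii) any two $n$-intervals $[\hat0,y]$, $[\hat0,v]$ with $y,v\neq\hat0$ have the same number $D(n)$ of maximal chains, and (iv) any two $n$-intervals $[x,y]$, $[u,v]$ with $x,u\neq\hat0$ have the same number $B(n)$ of maximal chains. A poset is Eulerian if $\mu(x,y)=(-1)^{\rho(y)-\rho(x)}$ for all $x\le y$. $\mathbb{B}_X$ is the poset of finite subsets of $X$ under inclusion. Let $\Pi=\{0,1,*\}$ be the three-element poset with $0<*$ and $1<*$, ranked by $\rho(0)=\rho(1)=0$, $\rho( * )=1$. The infinite cubical lattice is $\mathbb{C}_X^{<\infty} = \{f : X\to \Pi \;:\; f^{-1}( * ) \text{ and } f^{-1}(1) \text{ are finite}\}\cup\{\hat 0\}$, ordered componentwise ($f\le g$ iff $f(x)\le g(x)$ for all $x\in X$), with $\hat0$ a new minimum. *)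

(* Defs.v *)
From HB Require Import structures.
From mathcomp Require Import all_boot all_order all_algebra.
From mathcomp Require Import finmap.
From mathcomp Require Import all_classical.

Set Implicit Arguments.
Unset Strict Implicit.
Unset Printing Implicit Defensive.

Import Order.TTheory GRing.Theory.

Local Open Scope classical_set_scope.
Local Open Scope card_scope.
Local Open Scope order_scope.

Section Posets.
Context {d : Order.disp_t}.

Definition locally_finite (P : porderType d) : Prop :=
  forall x y : P, finite_set `[x, y].

Definition infinite_chain (P : porderType d) (C : set P) : Prop :=
  total_on C (fun x y => x <= y) /\ infinite_set C.

(* Chains of an interval are finite in a locally finite poset, hence the use of
   finite sets here. *)
Definition interval_chain (P : porderType d) (x y : P) (C : {fset P}) : Prop :=
  [set` C] `<=` `[x, y] /\ total_on [set` C] (fun u v => u <= v).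

Definition maximal_chain (P : porderType d) (x y : P) (C : {fset P}) : Prop :=
  interval_chain x y C /\
  forall C' : {fset P}, interval_chain x y C' -> (C `<=` C')%fset -> C' = C.

Definition maximal_chains (P : porderType d) (x y : P) : set {fset P} :=
  [set C | maximal_chain x y C].

Definition graded_interval (P : porderType d) (x y : P) : Prop :=
  forall C C' : {fset P},
    maximal_chain x y C -> maximal_chain x y C' -> #|` C| = #|` C'|.

(* The length (number of elements minus one) of a maximal chain of [\bot, x],
   which does not depend on the chosen chain when that interval is graded; see
   [rankE]. *)
Definition rank (P : bPOrderType d) (x : P) : nat :=
  #|` xget fset0 (maximal_chains \bot x)|.-1.

Definition n_interval (P : bPOrderType d) (n : nat) (x y : P) : Prop :=
  x <= y /\ rank y = (rank x + n)%N.

Record sheffer_poset (P : bPOrderType d) : Prop := {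
  sheffer_locally_finite : locally_finite P;
  sheffer_infinite_chain : exists C : set P, infinite_chain C;
  sheffer_graded : forall x y : P, x <= y -> graded_interval x y;
  sheffer_D : forall (n : nat) (y v : P), y <> \bot -> v <> \bot ->
    n_interval n \bot y -> n_interval n \bot v ->
    maximal_chains \bot y #= maximal_chains \bot v;
  sheffer_B : forall (n : nat) (x y u v : P), x <> \bot -> u <> \bot ->
    n_interval n x y -> n_interval n u v ->
    maximal_chains x y #= maximal_chains u v }.

(* The recursion mu(x, x) = 1, mu(x, y) = - \sum_(x <= z < y) mu(x, z), run for
   [n] steps; the size of [x, y] is enough fuel, see [moebius_lt]. *)
Fixpoint moebius_rec (P : porderType d) (n : nat) (x y : P) : int :=
  if n is n'.+1 then
    if x == y then 1%R else (- \sum_(z \in `[x, y[) moebius_rec n' x z)%R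
  else 0%R.

Definition moebius (P : porderType d) (x y : P) : int :=
  moebius_rec #|` fset_set `[x, y]| x y.

Definition eulerian (P : bPOrderType d) : Prop :=
  forall x y : P, x <= y -> moebius x y = ((-1) ^+ (rank y - rank x))%R.

Definition atom (P : bPOrderType d) (a : P) : Prop :=
  \bot < a /\ forall x : P, \bot < x -> x <= a -> x = a.

Definition atoms (P : bPOrderType d) : set P := [set a | atom a].

Definition rank2_above (P : bPOrderType d) (a : P) : set P :=
  [set x | rank x = 2 /\ a < x].

Lemma maximal_chain_neq0 (P : porderType d) (x y : P) (C : {fset P}) :
  x <= y -> maximal_chain x y C -> C != fset0.
Proof.
move=> xy [_ Cmax]; apply/eqP => C0; suff /fsetP/(_ x) : [fset x]%fset = C.
  by rewrite C0 !inE eqxx.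
apply: Cmax; last by rewrite C0 fsub0set.
split=> [z|s t].
  by rewrite /= inE => /eqP ->; rewrite in_itv/= lexx.
by rewrite /= !inE => /eqP -> /eqP ->; left.
Qed.

Lemma rankE (P : bPOrderType d) (x : P) (C : {fset P}) :
  graded_interval \bot x -> maximal_chain \bot x C -> #|` C| = (rank x).+1.
Proof.
move=> gr Cmax; have Dmax : maximal_chain \bot x
    (xget fset0 (maximal_chains \bot x)) by exact: (xgetPex fset0 (ex_intro _ C Cmax)).
by rewrite (gr _ _ Cmax Dmax) prednK// cardfs_gt0 (maximal_chain_neq0 _ Dmax)// le0x.
Qed.

Lemma moebiusxx (P : porderType d) (x : P) : moebius x x = 1%R.
Proof.
rewrite /moebius set_itv1 fset_set1 cardfs1 /=.
by rewrite eqxx.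
Qed.

Lemma mem_fset_itv (P : porderType d) (x y z : P) : locally_finite P ->
  (z \in fset_set `[x, y]) = (x <= z <= y).
Proof. by move=> fin; rewrite in_fset_set// mem_setE/= in_itv. Qed.

Lemma card_itv_gt0 (P : porderType d) (x y : P) : locally_finite P -> x <= y ->
  (0 < #|` fset_set `[x, y]|)%N.
Proof.
move=> fin xy; rewrite cardfs_gt0; apply/fset0Pn; exists x.
by rewrite mem_fset_itv// lexx.
Qed.

Lemma card_itv_lt (P : porderType d) (x y z : P) : locally_finite P ->
  x <= z -> z < y -> (#|` fset_set `[x, z]| < #|` fset_set `[x, y]|)%N.
Proof.
move=> fin xz zy; apply: fproper_ltn_card; rewrite fproperE; apply/andP; split.
  apply/fsubsetP => t; rewrite !mem_fset_itv// => /andP[-> tz].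
  exact: le_trans tz (ltW zy).
apply/fsubsetPn; exists y; rewrite mem_fset_itv// ?lexx ?andbT.
  exact: le_trans xz (ltW zy).
by rewrite (lt_geF zy) andbF.
Qed.

Lemma moebius_rec_stable (P : porderType d) (n m : nat) (x y : P) :
  locally_finite P -> (#|` fset_set `[x, y]| <= n)%N ->
  (#|` fset_set `[x, y]| <= m)%N -> x <= y ->
  moebius_rec n x y = moebius_rec m x y.
Proof.
move=> fin; elim: n m y => [|n IH] [|m] y hn hm xy //;
  try by have := card_itv_gt0 fin xy; rewrite lt0n -leqn0 ?hn ?hm.
rewrite /=; case: eqP => // _; congr (- _)%R; apply: eq_fsbigr => z.
rewrite mem_setE/= in_itv/= => /andP[xz zy].
have lt := card_itv_lt fin xz zy.
by apply: IH => //; rewrite -ltnS (leq_trans lt).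
Qed.

Lemma moebius_lt (P : porderType d) (x y : P) : locally_finite P -> x < y ->
  moebius x y = (- \sum_(z \in `[x, y[) moebius x z)%R.
Proof.
move=> fin xy; rewrite {1}/moebius; have := card_itv_gt0 fin (ltW xy).
case E : (#|` _|) => [//|n] _ /=; rewrite (lt_eqF xy); congr (- _)%R.
apply: eq_fsbigr => z; rewrite mem_setE/= in_itv/= => /andP[xz zy].
by apply: moebius_rec_stable => //; rewrite -ltnS -E card_itv_lt.
Qed.

Lemma sheffer_atom (P : bPOrderType d) :
  sheffer_poset P -> exists a : P, atom a.
Proof.
case=> fin [C [_ Cinf]] _ _ _.
have [y y0] : exists y : P, \bot < y.
  apply: contrapT => noy; apply: Cinf; apply: sub_finite_set (finite_set1 \bot).
  move=> y _ /=; apply/eqP/negPn/negP => yN0.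
  by apply: noy; exists y; rewrite lt0x.
pose Q n := `[< exists2 a : P, \bot < a & #|` fset_set `[\bot, a]| = n >].
have exQ : exists n, Q n by eexists; apply/asboolP; exists y.
case: (ex_minnP exQ) => n /asboolP[a a0 an] nmin; exists a; split=> // x x0 xa.
apply/eqP/negPn/negP => xNa; have xa' : x < a by rewrite lt_neqAle xNa.
have := card_itv_lt fin (le0x x) xa'; rewrite an ltnNge nmin//.
by apply/asboolP; exists x.
Qed.

End Posets.

Arguments atoms {d} P.

(* The three-element poset 0 < *, 1 < *. *)
Inductive cube_coord := Coord0 | Coord1 | CoordStar.

Definition cube_coord_code (s : cube_coord) : option bool :=
  match s with
  | Coord0 => Some false
  | Coord1 => Some true
  | CoordStar => None
  end.

Definition cube_coord_decode (s : option bool) : cube_coord :=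
  match s with
  | Some false => Coord0
  | Some true => Coord1
  | None => CoordStar
  end.

Lemma cube_coord_codeK : cancel cube_coord_code cube_coord_decode.
Proof. by case. Qed.

HB.instance Definition _ := Finite.copy cube_coord (can_type cube_coord_codeK).

Definition cube_coord_le (s t : cube_coord) : bool :=
  (s == t) || (t == CoordStar).

Lemma cube_coord_le_refl : reflexive cube_coord_le.
Proof. by case. Qed.

Lemma cube_coord_le_anti : antisymmetric cube_coord_le.
Proof. by case; case. Qed.

Lemma cube_coord_le_trans : transitive cube_coord_le.
Proof. by case; case; case. Qed.

Fact cube_coord_display : Order.disp_t. Proof. exact: Order.default_display. Qed.

HB.instance Definition _ := Order.Le_isPOrder.Build cube_coord_display cube_coord
  cube_coord_le_refl cube_coord_le_anti cube_coord_le_trans.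

Definition cube_face (X : Type) : set (X -> cube_coord) :=
  [set f | finite_set (f @^-1` [set CoordStar]) /\
           finite_set (f @^-1` [set Coord1])].

Arguments cube_face X : clear implicits.

(* [None] is the new minimum. *)
Definition infinite_cubical_lattice (X : Type) : Type := option (cube_face X).

(* The order on [X -> cube_coord] is the pointwise one, see [lefP]. *)
Definition cubical_le (X : Type) (f g : infinite_cubical_lattice X) : bool :=
  match f, g with
  | None, _ => true
  | Some _, None => false
  | Some f', Some g' => val f' <= val g'
  end.

Definition poset_isomorphic (T U : Type) (leT : rel T) (leU : rel U) : Prop :=
  exists2 f : T -> U, bijective f & {mono f : x y / leT x y >-> leU x y}.

(* Main.v *)
Require Import Defs.
From HB Require Import structures.
From mathcomp Require Import all_boot all_order all_algebra.
From mathcomp Require Import finmap.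
From mathcomp Require Import all_classical.
From mathcomp Require Import zify ring lra.

Set Implicit Arguments.
Unset Strict Implicit.
Unset Printing Implicit Defensive.

Import Order.TTheory GRing.Theory Num.Theory.

Local Open Scope fset_scope.
Local Open Scope nat_scope.
Local Open Scope order_scope.

(* Call [A n] (resp. [C n]) the number of elements covering [x] in an n-interval
   [[x, y]] with [x <> \bot] (resp. [x = \bot]); both are well defined since a
   maximal chain of [[x, y]] is an element covering [x] followed by a maximal
   chain above it.

   Counting the pairs (element covering [x], element of rank [k] above it) turns
   the Euler relation into recurrences for [A] and [C]. If [b] covers [x],
   joining with [b] is injective on the [c] for which [b `|` c] covers [b], and
   attains every element covering [b]; hence [A n > A (n - 1)]. For [n] even the
   Euler relation in length [n + 2] forces [A (n + 1) = n + 1] and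
   [A (n + 2) = n + 2]: all intervals above an atom are boolean. For [p j = 1 / C (j + 1)] the Euler relations say
   that [p] is its own binomial transform, [\sum_j (-1)^j 'C(m, j) p j = p m],
   which leaves only [C 3 = 3] and [C 3 = 4], with one unknown at each even
   index.
   - If [C 3 = 3], then adjacency of atoms is transitive, so [C (m + 1)] is
     [m + 1] or at least [2 (m + 1)]; the latter makes [p (m + 1)] nonpositive.
   - If [C 3 = 4], then adjacency is triangle-free, whence [C (n + 1) >= 2 C n];
     together with the integrality of the number of coatoms and the relations at
     [m + 1] and [m + 3] this forces [C (m + 1) = 2 ^ m].

   When [C n = n] every element is determined by the atoms below it, and every
   finite set of atoms occurs. When [C n = 2 ^ (n - 1)], fix an atom [a] and
   attach to an atom [b] the set of rank 2 elements of [[a, a `|` b]]. Counting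
   atoms shows that every finite set of rank 2 elements above [a] arises exactly
   once, adjacent atoms differ in exactly one coordinate, and opposite edges of
   a square have the same direction, so that the atoms below an element form a
   face of the cube. *)

(** * Finite sets *)

Section FiniteSets.
Local Open Scope nat_scope.

Lemma leq_card_inj (T U : choiceType) (f : T -> U) (A : {fset T})
    (B : {fset U}) :
  {in A, forall x, f x \in B} -> {in A &, injective f} -> #|` A| <= #|` B|.
Proof.
move=> fAB finj; rewrite -(card_in_imfset imfset_key finj).
by apply: fsubset_leq_card; apply/fsubsetP => _ /imfsetP[x xA ->]; exact: fAB.
Qed.

(** Pigeonhole principle: the counting arguments below use it to turn an inequality of cardinalities
    into surjectivity. *)
Lemma fset_inj_onto (T U : choiceType) (f : T -> U) (A : {fset T})
    (B : {fset U}) :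
  {in A, forall x, f x \in B} -> {in A &, injective f} -> #|` B| <= #|` A| ->
  {in B, forall y, exists2 x, x \in A & y = f x}.
Proof.
move=> fAB finj BA y yB; have /eqP fA : f @` A == B.
  rewrite eqEfcard card_in_imfset// BA andbT.
  by apply/fsubsetP => _ /imfsetP[x xA ->]; exact: fAB.
by move: yB; rewrite -fA => /imfsetP[x xA ->]; exists x.
Qed.

Lemma card_fset_cond (T : choiceType) (A : {fset T}) (P : pred T) :
  #|` [fset x in A | P x]| = \sum_(x <- A) P x.
Proof. by rewrite card_fset_sum1 big_fset/= big_mkcond. Qed.

Lemma in_fset_cond (T : choiceType) (A : {fset T}) (P : pred T) x :
  (x \in [fset z in A | P z]) = (x \in A) && P x.
Proof. by rewrite !inE. Qed.

End FiniteSets.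

(** * Maximal chains and rank *)

Section MaximalChains.
Context {d : Order.disp_t} {P : porderType d} (fin : locally_finite P).
Implicit Types x y z : P.
Implicit Types C : {fset P}.

Lemma interval_chainP x y C : interval_chain x y C <->
  {in C, forall u, x <= u <= y} /\ {in C &, forall u v, (u <= v) || (v <= u)}.
Proof.
split=> -[h1 h2]; split.
- by move=> u /h1 /=; rewrite in_itv.
- by move=> u v uC vC; apply/orP; exact: h2.
- by move=> u /h1 /=; rewrite in_itv.
- by move=> u v uC vC; apply/orP; exact: h2.
Qed.

(** The size of [[x, z]] drops strictly along [t < z], so an element of [C] minimizing it is minimal
    in [C]. *)
Lemma fset_minimal x y C : {in C, forall u, x <= u <= y} -> C != fset0 ->
  exists2 z, z \in C & {in C, forall t, ~~ (t < z)}.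
Proof.
move=> CI /fset0Pn[c cC].
pose Q n := `[< exists2 z, z \in C & #|` fset_set `[x, z]%classic| = n >].
have exQ : exists n, Q n by eexists; apply/asboolP; exists c.
case: (ex_minnP exQ) => n /asboolP[z zC zn] nmin; exists z => // t tC.
apply/negP => tz; have /andP[xt _] := CI t tC; have /andP[xz _] := CI z zC.
have := card_itv_lt fin xt tz; rewrite zn ltnNge nmin//.
by apply/asboolP; exists t.
Qed.

Definition covers x z := x < z /\ forall t, x < t -> ~~ (t < z).

Lemma covers_exists x y : x < y -> exists2 z, covers x z & z <= y.
Proof.
move=> xy.
have [t||z] := @fset_minimal x y [fset t in fset_set `[x, y]%classic | x < t].
- by rewrite !inE mem_fset_itv// => /andP[].
- by apply/fset0Pn; exists y; rewrite !inE mem_fset_itv//= lexx xy (ltW xy).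
rewrite !inE mem_fset_itv//= => /andP[/andP[_ zy] xz] zmin; exists z => //.
split=> // t xt; apply/negP => tz; have := zmin t.
by rewrite !inE mem_fset_itv//= (ltW xt) xt tz (le_trans (ltW tz) zy) => /(_ isT).
Qed.

Lemma maximal_chain_bounds x y C : x <= y -> maximal_chain x y C ->
  (x \in C) && (y \in C).
Proof.
move=> xy [/interval_chainP[CI Ctot] Cmax].
have add z : (z == x) || (z == y) -> z \in C.
  move=> zxy; rewrite -(Cmax (z |` C)) ?fset1U1 ?fsubsetU1//.
  have zI : x <= z <= y by case/orP: zxy => /eqP ->; rewrite lexx ?xy.
  apply/interval_chainP; split=> [u|u v].
    by rewrite !inE => /predU1P[->//|/CI].
  have cmp w : w \in C -> (z <= w) || (w <= z).
    move=> /CI/andP[xw wy].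
    by case/orP: zxy => /eqP ->; rewrite ?xw ?wy ?orbT.
  rewrite !inE => /predU1P[->|uC] /predU1P[->|vC]; rewrite ?lexx//; last exact: Ctot.
    exact: cmp.
  by rewrite orbC cmp.
by rewrite !add ?eqxx ?orbT.
Qed.

Lemma maximal_chain_cons x z y C : covers x z -> z <= y ->
  maximal_chain z y C -> maximal_chain x y (x |` C).
Proof.
move=> [xz xznot] zy Cmax; have /andP[zC yC] := maximal_chain_bounds zy Cmax.
case: Cmax => /interval_chainP[CI Ctot] Cmax.
have xC u : u \in C -> x <= u by move=> /CI/andP[+ _]; apply: le_trans (ltW xz).
split.
  apply/interval_chainP; split=> [u|u v].
    rewrite !inE => /predU1P[->|uC]; first by rewrite lexx (le_trans (ltW xz)).
    by rewrite xC//; case/andP: (CI u uC).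
  rewrite !inE => /predU1P[->|uC] /predU1P[->|vC]; rewrite ?lexx ?xC ?orbT//.
  exact: Ctot.
move=> C' /interval_chainP[C'I C'tot] /fsubsetP CC'.
have xC' : x \in C' by rewrite CC' ?fset1U1.
rewrite -(fsetD1K xC'); congr (_ |` _); apply: Cmax.
  apply/interval_chainP; split=> [u|u v]; rewrite !inE.
    move=> /andP[ux uC']; have /andP[xu ->] := C'I u uC'; rewrite andbT.
    have zC' : z \in C' by rewrite CC'// !inE zC orbT.
    have /orP[//|uz] := C'tot z u zC' uC'.
    have xu' : x < u by rewrite lt_neqAle eq_sym ux.
    by have := xznot u xu'; rewrite lt_neqAle uz andbT negbK => /eqP ->.
  by move=> /andP[_ uC'] /andP[_ vC']; exact: C'tot.
apply/fsubsetP => u uC; rewrite !inE CC' ?inE ?uC ?orbT// andbT.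
by apply/eqP => ux; have /andP[+ _] := CI u uC; rewrite ux (lt_geF xz).
Qed.

(** The least element of [C] other than [x] covers [x]: anything strictly between would be
    comparable to all of [C], hence in [C] by maximality. *)
Lemma maximal_chain_uncons x y C : x < y -> maximal_chain x y C ->
  exists z, [/\ covers x z, z <= y, z \in C & maximal_chain z y (C `\ x)].
Proof.
move=> xy Cmax; have /andP[xC yC] := maximal_chain_bounds (ltW xy) Cmax.
case: Cmax => /interval_chainP[CI Ctot] Cmax.
have [u||z] := @fset_minimal x y (C `\ x).
- by rewrite !inE => /andP[_ /CI].
- by apply/fset0Pn; exists y; rewrite !inE yC gt_eqF.
rewrite !inE => /andP[zx zC] zmin.
have zle u : u \in C -> u != x -> z <= u.
  move=> uC ux; have /orP[//|uz] := Ctot z u zC uC.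
  have := zmin u; rewrite !inE ux uC => /(_ isT).
  by rewrite lt_neqAle uz andbT negbK => /eqP ->.
have /andP[xz zy] := CI z zC.
exists z; split => //.
  split=> [|t xt]; first by rewrite lt_neqAle eq_sym zx.
  apply/negP => tz; have tC : t \in C.
    rewrite -(Cmax (t |` C)) ?fset1U1 ?fsubsetU1//.
    have cmp u : u \in C -> (t <= u) || (u <= t).
      move=> uC; have [->|ux] := eqVneq u x; first by rewrite (ltW xt) orbT.
      by rewrite (le_trans (ltW tz)) ?zle.
    apply/interval_chainP; split=> [u|u v].
      by rewrite !inE => /predU1P[->|/CI//]; rewrite (ltW xt) (le_trans (ltW tz)).
    rewrite !inE => /predU1P[->|uC] /predU1P[->|vC]; rewrite ?lexx ?cmp//.
      by rewrite orbC cmp.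
    exact: Ctot.
  by have := zle t tC; rewrite gt_eqF// => /(_ isT); rewrite (lt_geF tz).
have zDC : {in C `\ x, forall u, z <= u <= y}.
  by move=> u; rewrite !inE => /andP[ux uC]; rewrite zle//; case/andP: (CI u uC).
split.
  apply/interval_chainP; split => // u v.
  by rewrite !inE => /andP[_ uC] /andP[_ vC]; exact: Ctot.
move=> C' /interval_chainP[C'I C'tot] /fsubsetP CC'.
have xC' u : u \in C' -> x <= u by move=> /C'I/andP[+ _]; apply: le_trans.
have xNC' : x \notin C'.
  apply/negP => /C'I/andP[+ _]; rewrite lt_geF// lt_neqAle xz andbT.
  by rewrite eq_sym.
suff <- : x |` C' = C.
  by apply/fsetP => u; rewrite !inE; case: eqVneq => //= ->; exact/negbTE.
apply: Cmax.
  apply/interval_chainP; split=> [u|u v].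
    rewrite !inE => /predU1P[->|uC]; first by rewrite lexx ltW.
    by rewrite xC'//; case/andP: (C'I u uC).
  rewrite !inE => /predU1P[->|uC] /predU1P[->|vC]; rewrite ?lexx ?xC' ?orbT//.
  exact: C'tot.
apply/fsubsetP => u uC; rewrite !inE; have [//|ux /=] := eqVneq u x.
by apply: CC'; rewrite !inE ux.
Qed.

Lemma maximal_chain_exists x y : x <= y -> exists C, maximal_chain x y C.
Proof.
move En : #|` fset_set `[x, y]%classic| => n.
elim/ltn_ind: n => n IH in x En *.
rewrite le_eqVlt => /predU1P[<-|xy].
  exists [fset x]; split.
    apply/interval_chainP; split=> [u|u v]; rewrite !inE.
      by move/eqP ->; rewrite lexx.
    by move=> /eqP -> /eqP ->; rewrite lexx.
  move=> C /interval_chainP[CI _] xC; apply/eqP; rewrite eqEfsubset xC andbT.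
  by apply/fsubsetP => u /CI; rewrite -eq_le inE eq_sym.
have [z xz zy] := covers_exists xy.
have [|||C Cmax] := IH #|` fset_set `[z, y]%classic| _ z => //.
  rewrite -En; case: xz => xz _; apply: fproper_ltn_card; rewrite fproperE.
  apply/andP; split.
    apply/fsubsetP => t; rewrite !mem_fset_itv// => /andP[zt ->].
    by rewrite (le_trans (ltW xz)).
  by apply/fsubsetPn; exists x; rewrite mem_fset_itv// ?lexx ?(ltW xy)// (lt_geF xz).
by exists (x |` C); exact: maximal_chain_cons Cmax.
Qed.

Lemma finite_maximal_chains x y : finite_set (maximal_chains x y).
Proof.
apply: (@sub_finite_set _ _ [set` fpowerset (fset_set `[x, y]%classic)]) => //.
move=> C [/interval_chainP[CI _] _] /=; rewrite fpowersetE.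
by apply/fsubsetP => u /CI; rewrite mem_fset_itv.
Qed.

Definition nb_chains x y := #|` fset_set (maximal_chains x y)|.

Lemma mem_maximal_chains x y C :
  reflect (maximal_chain x y C) (C \in fset_set (maximal_chains x y)).
Proof.
rewrite in_fset_set; last exact: finite_maximal_chains.
by apply: (iffP idP); rewrite in_setE.
Qed.

Lemma nb_chains_gt0 x y : x <= y -> (0 < nb_chains x y)%N.
Proof.
move=> xy; have [C Cmax] := maximal_chain_exists xy.
by rewrite cardfs_gt0; apply/fset0Pn; exists C; exact/mem_maximal_chains.
Qed.

(** A maximal chain contains exactly one element [z] covering [x]; deleting and adding [x] are
    inverse bijections between the chains through [z] and the maximal chains of [[z, y]]. *)
Lemma nb_chains_rec x y (A : {fset P}) : x < y ->
  (forall z, reflect (covers x z /\ z <= y) (z \in A)) ->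
  nb_chains x y = (\sum_(z <- A) nb_chains z y)%N.
Proof.
move=> xy AP.
transitivity (\sum_(C <- fset_set (maximal_chains x y)) \sum_(z <- A) (z \in C))%N.
  rewrite /nb_chains card_fset_sum1; apply: eq_big_seq => C /mem_maximal_chains Cmax.
  have [z [xz zy zC zmax]] := maximal_chain_uncons xy Cmax.
  have zA : z \in A by apply/AP.
  rewrite (big_fsetD1 z)//= zC big1_fset// => t; rewrite !inE => /andP[tz tA] _.
  apply/eqP; rewrite eqb0; apply/negP => tC.
  have [[xt tnot] ty] := AP _ tA.
  have /andP[zt _] : z <= t <= y.
    case: zmax => /interval_chainP[/(_ t) + _] _; apply.
    by rewrite !inE tC gt_eqF.
  have zt' : z < t by rewrite lt_neqAle eq_sym tz.
  by case: xz => xz _; have := tnot z xz; rewrite zt'.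
rewrite exchange_big/=; apply: eq_big_seq => z /AP[xz zy].
rewrite -card_fset_cond /nb_chains.
have xNC C : maximal_chain z y C -> x \notin C.
  move=> [/interval_chainP[CI _] _]; apply/negP => /CI/andP[+ _].
  by case: xz => xz _; rewrite (lt_geF xz).
apply/eqP; rewrite eqn_leq; apply/andP; split.
  apply: (@leq_card_inj _ _ (fun C => C `\ x)) => [C|C C'].
    rewrite !inE => /andP[/mem_maximal_chains Cmax zC]; apply/mem_maximal_chains.
    have [t [xt ty tC tmax]] := maximal_chain_uncons xy Cmax.
    suff <- : t = z by [].
    have /andP[tz _] : t <= z <= y.
      case: tmax => /interval_chainP[/(_ z) + _] _; apply.
      by case: xz => xz _; rewrite !inE zC gt_eqF.
    case: xz => _ /(_ t); case: xt => xt _ /(_ xt).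
    by rewrite lt_neqAle tz andbT negbK => /eqP.
  rewrite !inE => /andP[/mem_maximal_chains Cmax _].
  move=> /andP[/mem_maximal_chains C'max _] CC'.
  have /andP[xC _] := maximal_chain_bounds (ltW xy) Cmax.
  have /andP[xC' _] := maximal_chain_bounds (ltW xy) C'max.
  by rewrite -(fsetD1K xC) CC' fsetD1K.
apply: (@leq_card_inj _ _ (fun C => x |` C)) => [C|C C'].
  move=> /mem_maximal_chains Cmax; rewrite !inE.
  have /andP[zC _] := maximal_chain_bounds zy Cmax.
  rewrite zC orbT andbT; apply/mem_maximal_chains.
  exact: maximal_chain_cons Cmax.
move=> /mem_maximal_chains Cmax /mem_maximal_chains C'max CC'.
by rewrite -(fsetU1K (xNC _ Cmax)) CC' fsetU1K ?xNC.
Qed.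

End MaximalChains.

Section Rank.
Context {d : Order.disp_t} {P : bPOrderType d}.
Context (fin : locally_finite P).
Context (gr : forall x y : P, x <= y -> graded_interval x y).
Implicit Types x y z : P.

Lemma rank_bot : rank (\bot : P) = 0%N.
Proof.
have [C Cmax] := maximal_chain_exists fin (le0x (\bot : P)).
apply/eqP; rewrite -eqSS -(rankE (gr (le0x _)) Cmax).
have CE : C = [fset \bot].
  apply/fsetP => u; rewrite inE; apply/idP/eqP => [|->].
    case: Cmax => /interval_chainP[CI _] _ /CI/andP[_ u0].
    by apply/eqP; rewrite eq_le u0 le0x.
  by case/andP: (maximal_chain_bounds (lexx _) Cmax).
by rewrite CE cardfs1.
Qed.

(** Adding [z] to a maximal chain of [[\bot, x]] gives a maximal chain of [[\bot, z]]. *)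
Lemma covers_rank x z : covers x z -> rank z = (rank x).+1.
Proof.
move=> [xz xznot].
have [C Cmax] := maximal_chain_exists fin (le0x x).
have zNC : z \notin C.
  case: (Cmax) => /interval_chainP[CI _] _.
  by apply/negP => /CI/andP[_]; rewrite lt_geF.
suff zCmax : maximal_chain \bot z (z |` C).
  have := rankE (gr (le0x _)) zCmax; rewrite cardfsU1 zNC add1n => -[<-].
  exact: (rankE (gr (le0x _)) Cmax).
have /andP[_ xC] := maximal_chain_bounds (le0x x) Cmax.
case: Cmax => /interval_chainP[CI Ctot] Cmax.
have Cz u : u \in C -> u <= z by move=> /CI/andP[_ /le_trans]; apply; exact: ltW.
split.
  apply/interval_chainP; split=> [u|u v]; rewrite ?le0x/= !inE.
    by move=> /predU1P[->|/Cz].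
  move=> /predU1P[->|uC] /predU1P[->|vC]; rewrite ?lexx ?Cz ?orbT//.
  exact: Ctot.
move=> C' /interval_chainP[C'I C'tot] /fsubsetP CC'.
have zC' : z \in C' by rewrite CC' ?fset1U1.
rewrite -(fsetD1K zC'); congr (_ |` _); apply: Cmax.
  apply/interval_chainP; split=> [u|u v]; rewrite ?le0x/= !inE.
    move=> /andP[uz uC']; have /andP[_ uz'] := C'I u uC'.
    have xC' : x \in C' by rewrite CC'// !inE xC orbT.
    have /orP[|//] := C'tot x u xC' uC'; rewrite le_eqVlt => /predU1P[->//|xu].
    by have := xznot u xu; rewrite lt_neqAle uz uz'.
  by move=> /andP[_ uC'] /andP[_ vC']; exact: C'tot.
apply/fsubsetP => u uC; rewrite !inE CC' ?inE ?uC ?orbT// andbT.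
by apply: contraNneq zNC => <-.
Qed.

Lemma rank_lt x y : x < y -> (rank x < rank y)%N.
Proof.
move En : #|` fset_set `[x, y]%classic| => n.
elim/ltn_ind: n => n IH in x En * => xy.
have [z xz] := covers_exists fin xy.
have <- := covers_rank xz; rewrite le_eqVlt => /predU1P[->//|zy].
apply/ltnW/(IH #|` fset_set `[z, y]%classic|) => //; rewrite -En.
case: xz => xz _; apply: fproper_ltn_card; rewrite fproperE.
apply/andP; split.
  apply/fsubsetP => t; rewrite !mem_fset_itv// => /andP[zt ->].
  by rewrite (le_trans (ltW xz)).
by apply/fsubsetPn; exists x; rewrite mem_fset_itv// ?lexx ?(ltW xy)// (lt_geF xz).
Qed.

Lemma rank_le x y : x <= y -> (rank x <= rank y)%N.
Proof. by rewrite le_eqVlt => /predU1P[->//|/rank_lt/ltnW]. Qed.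

Lemma rank_eq_le x y : x <= y -> (rank y <= rank x)%N -> x = y.
Proof.
by move=> + yx; rewrite le_eqVlt => /predU1P[//|/rank_lt]; rewrite ltnNge yx.
Qed.

Lemma rank_eq0 x : (rank x == 0%N) = (x == \bot).
Proof.
apply/eqP/eqP => [x0|->]; last exact: rank_bot.
by apply/esym/rank_eq_le; rewrite ?le0x ?x0.
Qed.

Lemma rank_gt0 x : (0 < rank x)%N = (x != \bot).
Proof. by rewrite lt0n rank_eq0. Qed.

Lemma rank_covers x z : x <= z -> rank z = (rank x).+1 -> covers x z.
Proof.
move=> xz rz; split=> [|t xt].
  by rewrite lt_neqAle xz andbT; apply/eqP => xz'; move: rz; rewrite xz'; lia.
apply/negP => tz; have := rank_lt xt; have := rank_lt tz; lia.
Qed.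

Definition level x y k : {fset P} :=
  [fset z in fset_set `[x, y]%classic | rank z == (rank x + k)%N].

Lemma in_level x y k z :
  (z \in level x y k) = [&& x <= z, z <= y & rank z == (rank x + k)%N].
Proof. by rewrite !inE mem_fset_itv//= andbA. Qed.

Lemma level0 x y : x <= y -> level x y 0 = [fset x].
Proof.
move=> xy; apply/fsetP => z; rewrite in_level inE addn0.
apply/and3P/eqP => [[xz _ /eqP rz]|->]; last by rewrite lexx.
by apply/esym/rank_eq_le; rewrite ?rz.
Qed.

Lemma level_top x y : x <= y -> level x y (rank y - rank x) = [fset y].
Proof.
move=> xy; apply/fsetP => z; rewrite in_level inE subnKC ?rank_le//.
apply/and3P/eqP => [[_ zy /eqP rz]|->]; last by rewrite lexx.
by apply/rank_eq_le; rewrite ?rz.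
Qed.

Lemma level_gt0 x y k : x <= y -> (k <= rank y - rank x)%N ->
  (0 < #|` level x y k|)%N.
Proof.
elim: k x => [|k IH] x xy kxy; first by rewrite level0// cardfs1.
have xy' : x < y.
  by rewrite lt_neqAle xy andbT; apply: contraTneq kxy => ->; rewrite subnn.
have [z xz zy] := covers_exists fin xy'.
have rz := covers_rank xz.
have : (0 < #|` level z y k|)%N by apply: IH => //; rewrite rz; lia.
rewrite !cardfs_gt0 => /fset0Pn[t]; rewrite in_level => /and3P[zt ty /eqP rt].
apply/fset0Pn; exists t; rewrite in_level ty rt rz addSnnS eqxx !andbT.
by case: xz => /ltW /le_trans -> //.
Qed.

Lemma level_exists x y n : x <= y -> (rank x <= n <= rank y)%N ->
  exists z, [/\ x <= z, z <= y & rank z = n].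
Proof.
move=> xy /andP[xn ny].
have : (0 < #|` level x y (n - rank x)|)%N by apply: level_gt0 => //; lia.
rewrite cardfs_gt0 => /fset0Pn[t]; rewrite in_level => /and3P[xt ty /eqP rt].
by exists t; rewrite xt ty rt subnKC.
Qed.

(* Double counting of the pairs [c <= z] with [c] in level 1 and [z] in level
   [k + 1]. *)
Lemma sum_level x y k :
  (\sum_(c <- level x y 1) #|` level c y k| =
   \sum_(z <- level x y k.+1) #|` level x z 1|)%N.
Proof.
transitivity
  (\sum_(c <- level x y 1) \sum_(z <- level x y k.+1) (c <= z)%O)%N.
  apply: eq_big_seq => c; rewrite in_level => /and3P[xc cy /eqP rc].
  rewrite -card_fset_cond; congr #|` _|; apply/fsetP => z.
  rewrite in_level in_fset_cond in_level rc addn1 addSnnS.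
  by case cz: (c <= z); rewrite ?andbF// (le_trans xc cz) andbT.
rewrite exchange_big/=; apply: eq_big_seq => z.
rewrite in_level => /and3P[xz zy /eqP rz].
rewrite -card_fset_cond; congr #|` _|; apply/fsetP => c.
rewrite in_level in_fset_cond in_level.
by case cz: (c <= z); rewrite ?andbF// (le_trans cz zy) andbT.
Qed.

Lemma nb_chains_level x y : x < y ->
  nb_chains x y = (\sum_(z <- level x y 1) nb_chains z y)%N.
Proof.
move=> xy; apply: nb_chains_rec => // z; rewrite in_level.
apply: (iffP and3P) => [[xz zy /eqP rz]|[xz zy]].
  by split=> //; apply: rank_covers; rewrite ?rz ?addn1.
by rewrite zy (covers_rank xz) addn1; case: xz => /ltW.
Qed.

End Rank.

Local Opaque level.

(** * Numbers of covers in a Sheffer poset *)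

Section Sheffer.
Context {d : Order.disp_t} {P : bPOrderType d} (HS : sheffer_poset P).
Implicit Types x y z u v : P.
Let fin := sheffer_locally_finite HS.
Let gr := sheffer_graded HS.

Lemma nb_chains_eq x y u v : x != \bot -> u != \bot -> x <= y -> u <= v ->
  (rank y - rank x = rank v - rank u)%N -> nb_chains x y = nb_chains u v.
Proof.
move=> /eqP x0 /eqP u0 xy uv rr.
apply/fcard_eq; try exact: finite_maximal_chains.
apply: (sheffer_B HS (n := (rank y - rank x)%N)) => //.
  by split=> //; rewrite subnKC// (rank_le fin gr xy).
by split=> //; rewrite rr subnKC// (rank_le fin gr uv).
Qed.

(** Every element covering the bottom starts the same number of chains, so B(n) is the number of
    covers times B(n-1), and the positive factor B(n-1) cancels. *)
Lemma card_level1_eq x y u v : x != \bot -> u != \bot -> x <= y -> u <= v ->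
  (rank y - rank x = rank v - rank u)%N ->
  #|` level x y 1| = #|` level u v 1|.
Proof.
move=> x0 u0 xy uv rr.
have := rank_le fin gr xy; have := rank_le fin gr uv => ruv rxy.
have [xyE|xyN] := eqVneq x y.
  have uvE : u = v by apply: (rank_eq_le fin gr uv); move: rr; rewrite xyE; lia.
  have level1E z : level z z 1 = fset0.
    apply/fsetP => t; rewrite (in_level fin) inE; apply/and3P => -[zt tz /eqP].
    by have := rank_le fin gr tz; lia.
  by rewrite xyE uvE !level1E.
have xy' : x < y by rewrite lt_neqAle xyN.
have rxy' := rank_lt fin gr xy'.
have uv' : u < v.
  rewrite lt_neqAle uv andbT; apply: contraTneq rxy' => uvE.
  by move: rr; rewrite uvE; lia.
have : (0 < #|` level x y 1|)%N by apply: (level_gt0 fin gr) => //; lia.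
rewrite cardfs_gt0 => /fset0Pn[w]; rewrite (in_level fin) => /and3P[xw wy /eqP rw].
have gen (s t : P) : s != \bot -> s < t -> (rank t - rank s = rank y - rank x)%N ->
    nb_chains s t = (#|` level s t 1| * nb_chains w y)%N.
  move=> s0 st rst; rewrite (nb_chains_level fin gr st) card_fset_sum1 big_distrl/=.
  apply: eq_big_seq => z; rewrite (in_level fin) => /and3P[sz zt /eqP rz].
  have gt0 (a b : P) : a <= b -> a != \bot -> b != \bot.
    by move=> ab; rewrite -!(rank_gt0 fin gr) => /leq_trans; apply; exact: (rank_le fin gr).
  rewrite mul1n; apply: nb_chains_eq => //; [exact: gt0 sz _|exact: gt0 xw _|].
  by rewrite rz rw !subnDA rst.
have := gen x y x0 xy' erefl; rewrite (nb_chains_eq (u := u) (v := v))// (gen u v)//.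
by move=> /eqP; rewrite eqn_pmul2r ?(nb_chains_gt0 fin)// => /eqP.
Qed.

(** The same factorization for D(n): the part of a chain above an atom is still counted by
    B(n-1). *)
Lemma card_level1_bot_eq y v : rank y = rank v ->
  #|` level \bot y 1| = #|` level \bot v 1|.
Proof.
move=> ryv.
have [y0|yN0] := eqVneq y \bot.
  have -> : v = \bot; last by rewrite y0.
  by apply/eqP; rewrite -(rank_eq0 fin gr) -ryv y0 (rank_bot fin gr).
have vN0 : v != \bot by rewrite -(rank_gt0 fin gr) -ryv (rank_gt0 fin gr).
have y0 : \bot < y by rewrite lt0x.
have v0 : \bot < v by rewrite lt0x.
have : (0 < #|` level \bot y 1|)%N.
  by apply: (level_gt0 fin gr) => //; rewrite ?le0x ?(rank_bot fin gr) ?subn0 ?(rank_gt0 fin gr).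
rewrite cardfs_gt0 => /fset0Pn[w]; rewrite (in_level fin) => /and3P[_ wy /eqP rw].
have gt0 (z : P) : rank z = (rank (\bot : P) + 1)%N -> z != \bot.
  by rewrite -(rank_gt0 fin gr) => ->; lia.
have gen (t : P) : \bot < t -> rank t = rank y ->
    nb_chains \bot t = (#|` level \bot t 1| * nb_chains w y)%N.
  move=> t0 rt; rewrite (nb_chains_level fin gr t0) card_fset_sum1 big_distrl/=.
  apply: eq_big_seq => z; rewrite (in_level fin) => /and3P[_ zt /eqP rz].
  by rewrite mul1n; apply: nb_chains_eq => //; rewrite ?gt0// rz rw rt.
have := gen y y0 erefl; rewrite (_ : nb_chains \bot y = nb_chains \bot v).
  rewrite (gen v v0 (esym ryv)) => /eqP.
  by rewrite eqn_pmul2r ?(nb_chains_gt0 fin)// => /eqP.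
apply/fcard_eq; try exact: finite_maximal_chains.
apply: (sheffer_D HS (n := rank y)); try exact/eqP.
  by split; rewrite ?le0x ?(rank_bot fin gr).
by split; rewrite ?le0x ?(rank_bot fin gr) ?ryv.
Qed.

End Sheffer.

(** * The Euler relation and neighbours *)

Section EulerianSheffer.
Context {d : Order.disp_t} {L : bLatticeType d}.
Context (HS : sheffer_poset L) (HE : eulerian L).
Implicit Types x y z b c p : L.
Let fin := sheffer_locally_finite HS.
Let gr := sheffer_graded HS.
Let in_level := in_level fin.
Let rank_le := rank_le fin gr.
Let rank_lt := rank_lt fin gr.
Let rank_eq_le := rank_eq_le fin gr.

(** The Möbius function sums to zero over [[x, y]]; its values are signs depending on the rank only,
    so the sum is grouped by rank. *)
Lemma euler_level x y : x < y ->
  (\sum_(k < (rank y - rank x).+1) (-1) ^+ k * #|` level x y k|%:R = 0 :> rat)%R.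
Proof.
move=> xy; set I := fset_set `[x, y]%classic.
have mu0 : (\sum_(z <- I) moebius x z = 0)%R.
  have yI : y \in I by rewrite mem_fset_itv// lexx ltW.
  have finy : finite_set `[x, y[%classic.
    apply: sub_finite_set (fin x y) => z /=; rewrite !in_itv/= => /andP[->].
    exact: ltW.
  rewrite (big_fsetD1 y)//= moebius_lt// fsbig_finite//=.
  rewrite (_ : I `\ y = fset_set `[x, y[%classic) ?addNr//.
  apply/fsetP => z; rewrite !inE mem_fset_itv// in_fset_set// mem_setE/= in_itv/=.
  by rewrite lt_neqAle; case: (z != y); rewrite ?andbF.
have {mu0} : (\sum_(z <- I) (-1) ^+ (rank z - rank x) = 0 :> rat)%R.
  transitivity ((\sum_(z <- I) moebius x z)%:~R : rat)%R; last by rewrite mu0.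
  rewrite rmorph_sum/=; apply: eq_big_seq => z.
  by rewrite mem_fset_itv// => /andP[xz _]; rewrite HE// rmorphXn/= rmorphN1.
move=> sum0; rewrite -[RHS]sum0 [RHS](@partition_big _ _ _ _ _ 'I_(rank y - rank x).+1 _
  (fun z => inord (rank z - rank x)) xpredT)//=.
apply: eq_bigr => k _.
rewrite card_fset_sum1 natr_sum mulr_sumr big_fset/= -/I.
rewrite big_seq_cond [RHS]big_seq_cond.
apply: eq_big => [z|z /andP[/= _ /eqP ->]]; last by rewrite addKn mulr1.
apply: andb_id2l; rewrite mem_fset_itv// => /andP[xz zy].
have := rank_le xz; have := rank_le zy => rzy rxz.
by rewrite -val_eqE/= inordK; [apply/eqP/eqP|]; lia.
Qed.

Lemma level1_self x : level x x 1 = fset0.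
Proof.
apply/fsetP => t; rewrite in_level inE; apply/and3P => -[_ tx /eqP].
by have := rank_le tx; lia.
Qed.

Lemma card_level1_rank1 x y : x <= y -> rank y = (rank x).+1 ->
  #|` level x y 1| = 1.
Proof.
move=> xy rxy; have := level_top fin gr xy; rewrite rxy subSnn => ->.
exact: cardfs1.
Qed.

Lemma card_level1_rank2 x y : x <= y -> rank y = (rank x).+2 ->
  #|` level x y 1| = 2.
Proof.
move=> xy rxy; have xy' : x < y.
  by rewrite lt_neqAle xy andbT; apply/eqP => xyE; move: rxy; rewrite xyE; lia.
have := euler_level xy'; have := level_top fin gr xy; have := level0 fin gr xy.
rewrite (_ : rank y - rank x = 2)%N; last lia.
rewrite !big_ord_recr big_ord0/= => -> ->; rewrite !cardfs1.
move=> e; apply/eqP; rewrite -(eqr_nat rat); apply/eqP.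
by move: e; rewrite expr0 expr1 expr2; lra.
Qed.

Lemma rank_join b c x : b \in level x (b `|` c) 1 -> c \in level x (b `|` c) 1 ->
  b != c -> (rank x + 2 <= rank (b `|` c))%N.
Proof.
rewrite !in_level => /and3P[xb _ /eqP rb] /and3P[xc _ /eqP rc] bc.
have : b < b `|` c.
  rewrite lt_neqAle leUl andbT; apply: contraNneq bc => bE.
  have cb : c <= b by rewrite bE leUr.
  by rewrite (rank_eq_le cb)// rb rc.
by move/rank_lt; lia.
Qed.

Definition neighbours x y b : {fset L} :=
  [fset c in level x y 1 | rank (b `|` c) == (rank x + 2)%N].

Lemma in_neighbours x y b c : (c \in neighbours x y b) =
  (c \in level x y 1) && (rank (b `|` c) == (rank x + 2)%N).
Proof. exact: in_fset_cond. Qed.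

Local Opaque neighbours.

Lemma neighbours_irrefl x y b : b \notin neighbours x y b.
Proof.
rewrite in_neighbours in_level joinxx; apply/negP.
by move=> /andP[/and3P[_ _ /eqP ->]]; lia.
Qed.

Lemma level1_rank2_uniq x e a b c : x <= e -> rank e = (rank x).+2 ->
  a \in level x e 1 -> b \in level x e 1 -> c \in level x e 1 ->
  a != b -> a != c -> b = c.
Proof.
move=> xe re ae be ce ab ac; apply: contraTeq isT => bc.
have : (size [:: a; b; c] <= #|` level x e 1|)%N.
  apply: uniq_leq_size => [|t]; first by rewrite /= !inE negb_or ab ac bc.
  by rewrite 3!in_cons in_nil orbF => /or3P[] /eqP ->.
by rewrite (card_level1_rank2 xe re).
Qed.

Lemma level1_trans x y z b : b \in level x y 1 -> y <= z -> b \in level x z 1.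
Proof.
by rewrite !in_level => /and3P[-> by_ ->] yz; rewrite (le_trans by_ yz).
Qed.

Lemma level1_restrict x y z b : b \in level x y 1 -> b <= z -> b \in level x z 1.
Proof. by rewrite !in_level => /and3P[-> _ ->] ->. Qed.

(* Joining with [b] identifies the neighbours of [b] with the elements
   covering [b]: a 2-interval has exactly two middle elements. *)
Lemma card_neighbours x y b : b \in level x y 1 ->
  #|` neighbours x y b| = #|` level b y 1|.
Proof.
move=> bxy; have := bxy; rewrite in_level => /and3P[xb by_ /eqP rb].
have neqb c : c \in neighbours x y b -> b != c.
  by move=> cn; apply: contraTneq cn => <-; exact: neighbours_irrefl.
apply/eqP; rewrite eqn_leq; apply/andP; split.
  apply: (@leq_card_inj _ _ (fun c => b `|` c)) => [c|c c'].
    rewrite in_neighbours !in_level => /andP[/and3P[xc cy rc] /eqP ->].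
    by rewrite leUl leUx by_ cy rb -addnA eqxx.
  move=> cn cn' bcE; have bc := neqb _ cn; have bc' := neqb _ cn'.
  move: cn; rewrite in_neighbours => /andP[cy /eqP rbc].
  move: cn'; rewrite in_neighbours => /andP[cy' _].
  apply: (@level1_rank2_uniq x (b `|` c) b _ _ _ _ _ _ _ bc bc').
  - by rewrite (le_trans xb) ?leUl.
  - by rewrite rbc addn2.
  - by apply: level1_restrict bxy _; rewrite leUl.
  - by apply: level1_restrict cy _; rewrite leUr.
  - by apply: level1_restrict cy' _; rewrite bcE leUr.
(* [c] is the second middle element of the 2-interval [[x, e]]. The membership condition stays
   inside the existential so that [choice] gives a total function; [b] is the default value. *)
have other e : exists c, e \in level b y 1 ->
    c \in neighbours x y b /\ b `|` c = e.
  case: (boolP (e \in level b y 1)) => [|eN]; last by exists b.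
  rewrite in_level => /and3P[be ey /eqP re].
  have xe := le_trans xb be.
  have re2 : rank e = (rank x).+2 by rewrite re rb; lia.
  have be1 : b \in level x e 1 by exact: level1_restrict bxy be.
  have := card_level1_rank2 xe re2; rewrite (cardfsD1 b) be1 add1n => -[/eqP].
  move=> /cardfs1P[c cE]; exists c => _.
  have : c \in level x e 1 `\ b by rewrite cE inE.
  rewrite in_fsetD1 => /andP[cb ce].
  have bce : b `|` c <= e.
    by move: ce; rewrite in_level leUx be => /and3P[].
  have cbc : c \in level x (b `|` c) 1 by exact: level1_restrict ce (leUr _ _).
  have bbc : b \in level x (b `|` c) 1 by exact: level1_restrict be1 (leUl _ _).
  have rbc := rank_join bbc cbc; rewrite eq_sym cb in rbc.
  have bcE : b `|` c = e by apply: rank_eq_le => //; rewrite re2 -addn2 rbc.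
  by rewrite in_neighbours bcE re2 addn2 eqxx (level1_trans ce).
have [f fP] := choice other.
apply: (@leq_card_inj _ _ f) => [e /fP[]//|e e' /fP[_ eE] /fP[_ eE'] fE].
by rewrite -eE fE.
Qed.

Lemma card_level1_gt x y b : b \in level x y 1 ->
  (#|` level b y 1| < #|` level x y 1|)%N.
Proof.
move=> bxy; rewrite -(card_neighbours bxy) -add1n.
rewrite -[X in (X + _)%N](_ : b \notin neighbours x y b = 1%N :> nat); last first.
  by rewrite neighbours_irrefl.
rewrite -cardfsU1; apply: fsubset_leq_card; apply/fsubsetP => c.
by rewrite in_fset1U => /predU1P[->//|]; rewrite in_neighbours => /andP[].
Qed.

(** An element of maximal rank in the infinite chain would bound the chain, which would then lie in
    a finite interval. So the chain has elements of large rank; join one with [y] and descend to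
    rank [n]. *)
Lemma rank_unbounded y n : (rank y <= n)%N -> exists2 z, y <= z & rank z = n.
Proof.
move=> yn; have [C [Ctot Cinf]] := sheffer_infinite_chain HS.
have [c Cc nc] : exists2 c, C c & (n <= rank c)%N.
  apply: contrapT => noc; apply: Cinf.
  have [->|/set0P[c0 Cc0]] := eqVneq C set0; first exact: finite_set0.
  pose Q m := `[< exists2 c, C c & rank c = m >].
  have exQ : exists m, Q m by exists (rank c0); apply/asboolP; exists c0.
  have leQ m : Q m -> (m <= n)%N.
    move=> /asboolP[c Cc <-]; rewrite leqNgt; apply/negP => nc.
    by apply: noc; exists c => //; exact: ltnW.
  case: (ex_maxnP exQ leQ) => m /asboolP[c Cc <-] mmax.
  apply: sub_finite_set (fin \bot c) => t Ct /=; rewrite in_itv/= le0x/=.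
  have [//|ct] := Ctot t c Ct Cc; rewrite (rank_eq_le ct)//.
  by apply: mmax; apply/asboolP; exists t.
have [|z [yz _ rz]] := level_exists fin gr (leUl y c) (n := n).
  by rewrite yn (leq_trans nc)// rank_le// leUr.
by exists z.
Qed.

End EulerianSheffer.

Local Opaque neighbours.

Lemma alternating_binomial_sum (R : comPzRingType) n :
  (\sum_(k < n.+2) (-1) ^+ k * 'C(n.+1, k)%:R = 0 :> R)%R.
Proof.
rewrite -[RHS](_ : ((1 - 1) ^+ n.+1 = 0)%R); last by rewrite subrr expr0n.
rewrite exprBn; apply: eq_bigr => k _.
by rewrite !expr1n !mulr1 mulr_natr.
Qed.

(** * Intervals above an atom *)

Section UpperIntervals.
Context {d : Order.disp_t} {L : bLatticeType d}.
Context (HS : sheffer_poset L) (HE : eulerian L).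
Implicit Types x y z b c p : L.
Let fin := sheffer_locally_finite HS.
Let gr := sheffer_graded HS.
Let in_level := in_level fin.
Let rank_le := rank_le fin gr.
Let rank_lt := rank_lt fin gr.

Definition small_boolean n := forall x y, x != \bot -> x <= y ->
  (rank y - rank x <= n)%N -> #|` level x y 1| = (rank y - rank x)%N.

Lemma neq_bot_le x y : x != \bot -> x <= y -> y != \bot.
Proof.
by rewrite -!(rank_gt0 fin gr) => x0 /rank_le; exact: leq_trans.
Qed.

Lemma small_boolean_level n x y k : small_boolean n -> x != \bot -> x <= y ->
  (rank y - rank x <= n)%N -> #|` level x y k| = 'C(rank y - rank x, k).
Proof.
move=> Hn; elim: k x => [|k IH] x x0 xy rxy.
  by rewrite level0// cardfs1 bin0.
have := sum_level fin x y k.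
rewrite (eq_big_seq (fun=> 'C((rank y - rank x).-1, k))) => [|c]; last first.
  rewrite in_level => /and3P[xc cy /eqP rc].
  rewrite IH//; [|exact: neq_bot_le xc|by lia].
  by congr 'C(_, _); lia.
rewrite [X in _ = X](eq_big_seq (fun=> k.+1)) => [|z]; last first.
  rewrite in_level => /and3P[xz zy /eqP rz].
  by have rzy := rank_le zy; rewrite Hn//; lia.
rewrite !big_const_seq !count_predT !iter_addn_0 mulnC => e.
apply/eqP; rewrite -(eqn_pmul2l (ltn0Sn k)) -e Hn//.
by rewrite mul_bin_diag.
Qed.

(** One length beyond the boolean range, the double count still determines every level below the top
    in terms of the number of covers of [x]. *)
Lemma level_pred_boolean n x y k : small_boolean n -> x != \bot -> x <= y ->
  (rank y - rank x = n.+1)%N -> (k < n)%N ->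
  (#|` level x y k.+1| * k.+1 = #|` level x y 1| * 'C(n, k))%N.
Proof.
move=> Hn x0 xy rxy kn; have := sum_level fin x y k.
rewrite (eq_big_seq (fun=> 'C(n, k))) => [|c]; last first.
  rewrite in_level => /and3P[xc cy /eqP rc].
  rewrite (small_boolean_level _ Hn)//; [|exact: neq_bot_le xc|by lia].
  by congr 'C(_, _); lia.
rewrite [X in _ = X](eq_big_seq (fun=> k.+1)) => [|z]; last first.
  rewrite in_level => /and3P[xz zy /eqP rz].
  by have rzy := rank_le zy; rewrite Hn//; lia.
by rewrite !big_const_seq !count_predT !iter_addn_0 ![(_ * #|` _|)%N]mulnC.
Qed.

(** With [N] and [M] the numbers of covers in lengths [n + 3] and [n + 2], the Euler relation in the
    even length [n + 3] becomes [N M = (N - 1) (n + 3)]. Strict growth of the number of covers gives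
    [M >= n + 2], which leaves one solution. *)
Lemma small_boolean_step n : odd n -> small_boolean n.+1 -> small_boolean n.+3.
Proof.
move=> nodd Hn.
suff key x y c : x != \bot -> x <= y -> (rank y - rank x = n.+3)%N ->
    c \in level x y 1 ->
    #|` level c y 1| = n.+2 /\ #|` level x y 1| = n.+3.
  have some x y : x != \bot -> x <= y -> (rank y - rank x = n.+3)%N ->
      exists2 c, c \in level x y 1 & #|` level x y 1| = n.+3.
    move=> x0 xy rxy.
    have : (0 < #|` level x y 1|)%N by apply: (level_gt0 fin gr) => //; lia.
    by rewrite cardfs_gt0 => /fset0Pn[c cxy]; exists c => //; case: (key x y c).
  move=> x y x0 xy; rewrite leq_eqVlt => /predU1P[rxy|].
    by have [c _ ->] := some x y x0 xy rxy.
  rewrite ltnS leq_eqVlt => /predU1P[rxy|]; last exact: Hn.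
  have := rank_le xy => rxy'.
  (* Length [n + 2] is reached by adding one rank on top: [key] for [[x, z]] also counts the covers
     of [c] in [[c, z]], which has the length of [[x, y]]. *)
  have [z yz rz] := rank_unbounded HS (leqnSn (rank y)).
  have xz := le_trans xy yz.
  have rxz : (rank z - rank x = n.+3)%N by rewrite rz; lia.
  have [c cxz _] := some x z x0 xz rxz; have [cz _] := key x z c x0 xz rxz cxz.
  move: cxz; rewrite in_level => /and3P[xc cz' /eqP rc].
  rewrite rxy -cz; apply: (card_level1_eq HS) => //; first exact: neq_bot_le xc.
  by rewrite rz rc; lia.
move=> x0 xy rxy cxy; have rxy' := rank_le xy.
set N := #|` level x y 1|; set M := #|` level c y 1|.
have ME z : z \in level x y 1 -> #|` level z y 1| = M.
  move: cxy; rewrite !in_level => /and3P[xc cy /eqP rc] /and3P[xz zy /eqP rz].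
  apply: (card_level1_eq HS) => //; [exact: neq_bot_le xz|exact: neq_bot_le xc|].
  by rewrite rz rc.
have rlevel z : z \in level x y 1 ->
    [/\ z != \bot, z <= y & (rank y - rank z = n.+2)%N].
  rewrite in_level => /and3P[xz zy /eqP rz]; split=> //.
    exact: neq_bot_le xz.
  by rewrite rz; lia.
have Mn : (n.+1 < M)%N.
  have [c0 cy rcy] := rlevel c cxy.
  have : (0 < #|` level c y 1|)%N by apply: (level_gt0 fin gr) => //; lia.
  rewrite cardfs_gt0 => /fset0Pn[e ecy].
  apply: leq_trans (card_level1_gt HS HE ecy); rewrite ltnS.
  move: ecy; rewrite in_level => /and3P[ce ey /eqP re].
  by rewrite Hn ?(neq_bot_le c0 ce)//; lia.
have mid k : (k < n)%N ->
    (n.+2 * n.+3 * #|` level x y k.+2| = N * M * 'C(n.+3, k.+2))%N.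
  move=> kn; have := sum_level fin x y k.+1.
  rewrite [X in _ = X](eq_big_seq (fun=> k.+2)) => [|z]; last first.
    rewrite in_level => /and3P[xz zy /eqP rz].
    by rewrite Hn//; lia.
  rewrite big_const_seq count_predT iter_addn_0 => e.
  have {e} : (n.+2 * (k.+2 * #|` level x y k.+2|) = N * (M * 'C(n.+2, k.+1)))%N.
    rewrite -e big_distrr/= (eq_big_seq (fun=> M * 'C(n.+2, k.+1)))%N.
      by rewrite big_const_seq count_predT iter_addn_0 mulnC.
    move=> z zxy; have [z0 zy rzy] := rlevel z zxy.
    have := level_pred_boolean Hn z0 zy rzy (leqW kn); rewrite (ME z zxy) => ez.
    apply/eqP; rewrite -(eqn_pmul2l (ltn0Sn k)); apply/eqP.
    have := mul_bin_diag n.+2 k; rewrite /= => e'.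
    by rewrite mulnCA [(k.+1 * _)%N]mulnC ez mulnCA e' mulnCA.
  have := mul_bin_diag n.+3 k.+1; rewrite /= => e' e.
  apply/eqP; rewrite -(eqn_pmul2l (ltn0Sn k.+1)); apply/eqP.
  transitivity (n.+3 * (n.+2 * (k.+2 * #|` level x y k.+2|)))%N.
    by rewrite !mulnA; congr muln; lia.
  by rewrite e (mulnA N) mulnCA e' mulnCA.
have last : #|` level x y n.+2| = N.
  have := sum_level fin x y n.+1.
  rewrite (eq_big_seq (fun=> M)) => [|z zxy]; last first.
    have [z0 zy rzy] := rlevel z zxy.
    have := level_pred_boolean Hn z0 zy rzy (ltnSn n).
    by rewrite (ME z zxy) binSn => /eqP; rewrite eqn_pmul2r// => /eqP.
  rewrite [X in _ = X](eq_big_seq (fun=> M)) => [|z]; last first.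
    rewrite in_level => /and3P[xz zy /eqP rz].
    have [c0 cy rcy] := rlevel c cxy.
    by apply: (card_level1_eq HS) => //; rewrite rz; lia.
  rewrite !big_const_seq !count_predT !iter_addn_0 => /eqP.
  by rewrite eqn_pmul2l ?(leq_trans _ Mn)// => /eqP.
have xy' : x < y.
  by rewrite lt_neqAle xy andbT; apply/eqP => xyE; move: rxy; rewrite xyE; lia.
(* By [mid], the levels 2 to [n + 1] are [lam] times the binomial coefficients. Subtracting [lam]
   times the vanishing alternating binomial sum leaves only the two terms at each end. *)
pose lam : rat := ((N * M)%:R / (n.+2 * n.+3)%:R)%R.
have := euler_level HS HE xy'; rewrite rxy.
have : (\sum_(k < n.+4) (-1) ^+ k * (#|` level x y k|%:R - lam * 'C(n.+3, k)%:R) =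
    (1 - lam) - (N%:R - lam * n.+3%:R) - (N%:R - lam * n.+3%:R) + (1 - lam))%R.
  rewrite big_ord_recr big_ord_recr big_ord_recl/= big_ord_recl/=.
  rewrite big1 => [|k _]; last first.
    apply/eqP; rewrite mulf_eq0 subr_eq0; apply/orP; right.
    rewrite -(inj_eq (mulfI (_ : (n.+2 * n.+3)%:R != 0 :> rat)%R)) ?pnatr_eq0//.
    rewrite mulrA [(_ * lam)%R]mulrC divfK ?pnatr_eq0// -!natrM.
    by rewrite mid// ltnS ltn_ord.
  have -> : ((-1) ^+ n.+2 = -1 :> rat)%R by rewrite -signr_odd/= nodd.
  have -> : ((-1) ^+ n.+3 = 1 :> rat)%R by rewrite -signr_odd/= nodd.
  have := level_top fin gr xy; rewrite rxy => ->.
  rewrite level0// !cardfs1 last binn bin0 -/N bin1 binSn.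
  by rewrite expr0 expr1 !mul1r !mulr1; ring.
under eq_bigr do rewrite mulrBr mulrCA.
rewrite sumrB -mulr_sumr alternating_binomial_sum mulr0 subr0 => -> e.
have {e} e : (lam * n.+2%:R = N%:R - 1)%R.
  by move: e; rewrite -[n.+3]add1n natrD; lra.
have N0 : (0 < N)%N by rewrite cardfs_gt0; apply/fset0Pn; exists c.
have NM : (N * M = (N - 1) * n.+3)%N.
  apply/eqP; rewrite -(eqr_nat rat) !natrM natrB// -e /lam natrM.
  by apply/eqP; field; rewrite -!natrD !pnatr_eq0.
have {N0} [N' NE] : exists N', N = N'.+1 by exists N.-1; rewrite prednK.
rewrite NE subn1/= in NM *.
have ME' : M = n.+2.
  apply/eqP; rewrite eqn_leq Mn andbT leqNgt; apply/negP => MM.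
  have : (N'.+1 * n.+3 <= N'.+1 * M)%N by rewrite leq_mul2l MM orbT.
  by rewrite NM leq_pmul2r// ltnn.
rewrite ME' in NM *; split=> //; congr S.
by move: NM; rewrite !mulSn !mulnS; lia.
Qed.

Lemma card_level1_upper x y : x != \bot -> x <= y ->
  #|` level x y 1| = (rank y - rank x)%N.
Proof.
have H2 : small_boolean 2.
  move=> {}x {}y x0 xy; have := rank_le xy => rxy.
  case rE : (rank y - rank x)%N => [|[|[|//]]] _.
  - have -> : x = y by apply: (rank_eq_le fin gr) => //; lia.
    by rewrite (level1_self HS).
  - by rewrite (card_level1_rank1 HS)//; lia.
  - by rewrite (card_level1_rank2 HS HE)//; lia.
have Hall n : small_boolean n.*2.+2.
  elim: n => [//|n IH]; rewrite doubleS; apply: small_boolean_step => //.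
  by rewrite /= odd_double.
by move=> x0 xy; apply: (Hall (rank y - rank x)%N) => //; rewrite -addnn; lia.
Qed.

End UpperIntervals.

(** * Boolean intervals *)

Section Sublattices.
Context {d : Order.disp_t} {L : bLatticeType d}.
Context (HS : sheffer_poset L).
Implicit Types x y z b c p : L.
Let fin := sheffer_locally_finite HS.
Let gr := sheffer_graded HS.
Let in_level := in_level fin.
Let rank_le := rank_le fin gr.
Let rank_eq_le := rank_eq_le fin gr.

Lemma level1_mono p z w : z <= w -> level p z 1 `<=` level p w 1.
Proof.
move=> zw; apply/fsubsetP => b; rewrite !in_level => /and3P[-> bz ->].
by rewrite (le_trans bz zw).
Qed.

(** The meet of [z] and [w] has the same elements of rank one over [p] as [z], so by hypothesis the
    same rank as [z], and equals [z]. *)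
Lemma level1_sub_le p z w :
  (forall t, p <= t -> t <= z -> #|` level p z 1| = #|` level p t 1| ->
    rank t = rank z) ->
  p <= z -> p <= w -> level p z 1 `<=` level p w 1 -> z <= w.
Proof.
move=> inj pz pw /fsubsetP sub.
have pzw : p <= z `&` w by rewrite lexI pz.
suff zE : z `&` w = z by rewrite -zE leIr.
apply: rank_eq_le; rewrite ?leIl//.
rewrite (inj (z `&` w)) ?leIl//; apply/eqP.
rewrite eqn_leq (fsubset_leq_card (level1_mono _ (leIl _ _))) andbT.
apply: fsubset_leq_card.
apply/fsubsetP => b bz; have := sub b bz; move: bz; rewrite !in_level.
by move=> /and3P[-> bz ->] /and3P[_ bw _]; rewrite lexI bz bw.
Qed.

Definition boolean_above p := forall x y, p <= x -> x <= y ->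
  #|` level x y 1| = (rank y - rank x)%N.

Section BooleanAbove.
Context {p : L} (Hp : boolean_above p).

Lemma boolean_level1_sub z w : p <= z -> p <= w ->
  (level p z 1 `<=` level p w 1) = (z <= w).
Proof.
move=> pz pw; apply/idP/idP; last exact: level1_mono.
apply: level1_sub_le => // t pt tz; rewrite !Hp//.
by have := rank_le tz; have := rank_le pt; lia.
Qed.

Lemma boolean_level1_inj z w : p <= z -> p <= w ->
  level p z 1 = level p w 1 -> z = w.
Proof.
move=> pz pw e; apply/eqP; rewrite eq_le.
by rewrite -(boolean_level1_sub pz pw) -(boolean_level1_sub pw pz) e fsubset_refl.
Qed.

(* The elements covering [z] below [z `|` b] correspond to the elements of
   [level p (z `|` b) 1] which are not below [z], so one of them is above
   [b]. *)
Lemma boolean_rank_join z b : p <= z -> p <= b -> rank b = (rank p).+1 ->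
  (rank (z `|` b) <= (rank z).+1)%N.
Proof.
move=> pz pb rb; set Y := z `|` b.
have zY : z <= Y by exact: leUl.
have bY : b <= Y by exact: leUr.
have [bz|bz] := boolP (b <= z); first by rewrite /Y (join_l bz).
have bD : [fset b] \in fset1 @` (level p Y 1 `\` level p z 1)%fset.
  apply/imfsetP; exists b => //=.
  by rewrite in_fsetD !in_level pb bY (negbTE bz) rb addn1 eqxx.
have eP e : e \in level z Y 1 ->
    [/\ p <= e, z <= e, e <= Y & rank e = (rank z).+1].
  rewrite in_level => /and3P[ze eY /eqP ->].
  by rewrite (le_trans pz ze) ze eY addn1.
have subz e : e \in level z Y 1 -> level p z 1 `<=` level p e 1.
  by move=> /eP[_ ze _ _]; exact: level1_mono.
have cardD e : e \in level z Y 1 ->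
    #|` (level p e 1 `\` level p z 1)%fset| = 1.
  move=> eY; have [pe ze _ re] := eP e eY; rewrite cardfsDS ?subz// !Hp// re.
  by have := rank_le pz; lia.
have [e eY bE] : exists2 e, e \in level z Y 1 &
    [fset b] = (level p e 1 `\` level p z 1)%fset.
  apply: (@fset_inj_onto L {fset L}
    (fun e => level p e 1 `\` level p z 1)%fset (level z Y 1) _ _ _ _ _ bD).
  - move=> e eY; have /eqP/cardfs1P[c cE] := cardD e eY.
    rewrite cE; apply/imfsetP; exists c => //=.
    have : c \in (level p e 1 `\` level p z 1)%fset by rewrite cE inE.
    rewrite !in_fsetD => /andP[-> ce]; rewrite (fsubsetP (level1_mono _ _) _ ce)//.
    by have [] := eP e eY.
  - move=> e e' eY eY' ee'; have [pe _ _ _] := eP e eY; have [pe' _ _ _] := eP e' eY'.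
    apply: boolean_level1_inj => //.
    have := subz e eY; have := subz e' eY' => /fsubsetP s' /fsubsetP s.
    apply/fsetP => c; have := congr1 (fun A : {fset L} => c \in A) ee'.
    rewrite !in_fsetD; have := s c; have := s' c.
    case: (c \in level p z 1) => [/(_ isT) -> /(_ isT) -> _|_ _]; first by [].
    exact: id.
  - rewrite card_in_imfset/=; last by move=> ? ? _ _; exact: fset1_inj.
    rewrite -[size _]/(#|` _|) cardfsDS ?level1_mono// !Hp//.
    + by have := rank_le pz; lia.
    + exact: le_trans zY.
have [pe ze _ re] := eP e eY.
rewrite -re; apply: rank_le; rewrite leUx ze/=.
have : b \in (level p e 1 `\` level p z 1)%fset by rewrite -bE inE.
by rewrite in_fsetD !in_level => /andP[_ /and3P[]].
Qed.

(** The elements of [S] are joined one at a time. Each join raises the rank by at most one, so no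
    unwanted cover of [p] appears. *)
Lemma boolean_level1_onto (S : {fset L}) :
  {in S, forall s, p <= s /\ rank s = (rank p).+1} ->
  exists2 z, p <= z & level p z 1 = S.
Proof.
move Sn : #|` S| => n; elim: n => [|n IH] in S Sn * => SP.
  exists p => //; rewrite (cardfs0_eq Sn); exact: level1_self.
have [s sS] : exists s, s \in S by apply/fset0Pn; rewrite -cardfs_gt0 Sn.
have SDn : #|` S `\ s| = n by move: Sn; rewrite (cardfsD1 s) sS add1n => -[].
have [t tS|z pz zS] := IH (S `\ s) SDn.
  by apply: SP; move: tS; rewrite in_fsetD1 => /andP[].
have [ps rs] := SP s sS; exists (z `|` s); first exact: le_trans (leUl _ _).
apply/esym/eqP; rewrite eqEfcard; apply/andP; split.
  apply/fsubsetP => t tS; have [->|ts] := eqVneq t s.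
    by rewrite in_level ps leUr rs addn1 eqxx.
  apply: (fsubsetP (level1_mono p (leUl z s))).
  by rewrite zS in_fsetD1 ts.
have := boolean_rank_join pz ps rs; rewrite Sn -SDn -zS.
rewrite !Hp// ?(le_trans pz (leUl _ _))//.
by have := rank_le pz; lia.
Qed.

End BooleanAbove.

End Sublattices.

(** Isomorphisms are built from the model to the lattice; an order embedding is injective, and a
    section of it is the required map. *)
Lemma poset_isomorphic_surj (T U : Type) (leT : rel T) (leU : rel U)
    (h : U -> T) : antisymmetric leU -> reflexive leT ->
  (forall u v, leT (h u) (h v) = leU u v) ->
  (forall t, exists u, h u = t) -> poset_isomorphic leT leU.
Proof.
move=> anti refl hmono hsurj; have [f fK] := choice hsurj.
exists f; last by move=> x y; rewrite -hmono !fK.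
exists h; first exact: fK.
by move=> u; apply: anti; rewrite -!hmono !fK !refl.
Qed.

Lemma fset_sub_imfset (T : choiceType) (X : set T) (A : {fset T}) :
  {in A, forall x, X x} -> exists S : {fset X}, val @` S = A.
Proof.
move=> AX; exists [fset x : X in pmap insub A].
apply/fsetP => x; apply/imfsetP/idP => /= [[y]|xA].
  by rewrite inE/= mem_pmap_sub => yA ->.
have xX : x \in X by rewrite inE; exact: AX.
by exists (Sub x xX); rewrite ?SubK// inE/= mem_pmap_sub SubK.
Qed.

(** * The isomorphism with finite sets of atoms *)

Section BooleanLattice.
Context {d : Order.disp_t} {L : bLatticeType d} (HS : sheffer_poset L).
Let fin := sheffer_locally_finite HS.
Let gr := sheffer_graded HS.

Lemma atomP (a : L) : atom a <-> rank a = 1.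
Proof.
split=> [[a0 amin]|ra].
  have [b bc ba] := covers_exists fin a0.
  by rewrite -(amin b) ?(covers_rank fin gr bc) ?(rank_bot fin gr)//; case: bc.
have aN0 : a != \bot by rewrite -(rank_gt0 fin gr) ra.
split=> [|x]; first by rewrite lt0x.
rewrite lt0x -(rank_gt0 fin gr) => x0 xa.
by apply: (rank_eq_le fin gr) => //; rewrite ra.
Qed.

Lemma boolean_isomorphic : boolean_above (\bot : L) ->
  poset_isomorphic (fun x y : L => (x <= y)%O)
    (fun A B : {fset atoms L} => (A `<=` B)%fset).
Proof.
move=> H0.
have real (S : {fset atoms L}) : exists z, level \bot z 1 = val @` S.
  have [s|z _ zS] := boolean_level1_onto HS H0 (S := val @` S); last by exists z.
  move=> /imfsetP[a /= _ ->]; rewrite le0x (rank_bot fin gr); split=> //.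
  by apply/atomP; have := valP a; rewrite inE.
have [h hE] := choice real.
apply: (@poset_isomorphic_surj _ _ _ _ h) => [A B|x|A B|z].
- by rewrite -eqEfsubset => /eqP.
- exact: lexx.
- rewrite -(boolean_level1_sub HS H0) ?le0x// !hE.
  apply/fsubsetP/fsubsetP => sub x.
    by move=> xA; have := sub (val x); rewrite !(mem_imfset _ _ val_inj)/=; apply.
  by move=> /imfsetP[a /= /sub aB ->]; rewrite in_imfset.
have [|S SE] := @fset_sub_imfset _ (atoms L) (level \bot z 1).
  by move=> x; rewrite (in_level fin) (rank_bot fin gr) => /and3P[_ _ /eqP rx]; exact/atomP.
exists S; apply: (boolean_level1_inj HS H0); rewrite ?le0x//.
by rewrite hE SE.
Qed.

End BooleanLattice.

(** * Atoms and their adjacency *)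

Section Atoms.
Context {d : Order.disp_t} {L : bLatticeType d}.
Context (HS : sheffer_poset L) (HE : eulerian L).
Implicit Types x y z b c p q : L.
Let fin := sheffer_locally_finite HS.
Let gr := sheffer_graded HS.
Let in_level := in_level fin.
Let rank_le := rank_le fin gr.
Let rank_lt := rank_lt fin gr.
Let rank_eq_le := rank_eq_le fin gr.
Let rank_bot := rank_bot fin gr.

Lemma rank1_neq_bot b : rank b = 1 -> b != \bot.
Proof. by move=> rb; rewrite -(rank_gt0 fin gr) rb. Qed.

Lemma boolean_above_atom b : rank b = 1 -> boolean_above b.
Proof.
move=> rb x y bx xy; apply: (card_level1_upper HS HE) => //.
exact: (neq_bot_le HS (rank1_neq_bot rb)).
Qed.

Lemma in_atoms_below y b : (b \in level \bot y 1) = (b <= y) && (rank b == 1%N).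
Proof. by rewrite in_level le0x rank_bot. Qed.

Definition adjacent b c := [&& rank b == 1%N, rank c == 1%N & rank (b `|` c) == 2].

Lemma adjacent_sym b c : adjacent b c = adjacent c b.
Proof. by rewrite /adjacent joinC andbCA. Qed.

Lemma adjacent_neq b c : adjacent b c -> b != c.
Proof.
by apply: contraTneq => ->; apply/negP; rewrite /adjacent joinxx => /and3P[/eqP ->].
Qed.

Lemma mem_neighbours y b c : rank b = 1 ->
  (c \in neighbours \bot y b) = (c <= y) && adjacent b c.
Proof.
by move=> rb; rewrite in_neighbours in_atoms_below rank_bot /adjacent rb -andbA.
Qed.

Lemma card_neighbours_atom y b : rank b = 1 -> b <= y ->
  #|` neighbours \bot y b| = (rank y).-1.
Proof.
move=> rb by_; rewrite (card_neighbours HS HE); last first.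
  by rewrite in_atoms_below by_ rb.
by rewrite (boolean_above_atom rb)// rb subn1.
Qed.

(** Above [p] everything is boolean, so joining [p]|[c] to [p]|[b] raises the rank by at most one;
    it does raise it, since a rank 2 element lies above two atoms only. *)
Lemma rank_join_adjacent p b c : adjacent p b -> adjacent p c -> b != c ->
  rank ((p `|` b) `|` (p `|` c)) = 3.
Proof.
move=> pb pc bc; have := pb; have := pc.
move=> /and3P[/eqP rp /eqP rc /eqP rpc] /and3P[_ /eqP rb /eqP rpb].
apply/eqP; rewrite eqn_leq; apply/andP; split.
  rewrite -[X in (_ <= X)%N]/(2.+1) -rpb.
  apply: (boolean_rank_join HS (boolean_above_atom rp)); rewrite ?leUl//.
  by rewrite rp rpc.
rewrite -[X in (X <= _)%N]/(2.+1) -rpb; apply: rank_lt.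
rewrite lt_neqAle leUl andbT; apply: contraNneq bc => bcE.
have cpb : c <= p `|` b by rewrite bcE (le_trans (leUr c p)) ?leUr.
apply/eqP/(level1_rank2_uniq HS HE (x := \bot) (e := p `|` b) (a := p)).
- exact: le0x.
- by rewrite rank_bot.
- by rewrite in_atoms_below leUl rp.
- by rewrite in_atoms_below leUr rb.
- by rewrite in_atoms_below cpb rc.
- exact: adjacent_neq.
- exact: adjacent_neq.
Qed.

(** This is the number [C n] of the overview. Any element of rank [n] serves, by
    [card_level1_bot_eq], and one exists by [rank_exists]. *)
Definition valency n := #|` level \bot (xget \bot [set y : L | rank y = n]%classic) 1|.

Lemma rank_exists n : exists y : L, rank y = n.
Proof.
by have [|y _ ry] := @rank_unbounded _ _ HS \bot n; [rewrite rank_bot|exists y].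
Qed.

Lemma card_atoms_below y : #|` level \bot y 1| = valency (rank y).
Proof.
apply: (card_level1_bot_eq HS).
by have := xgetPex \bot (rank_exists (rank y)) => /= ->.
Qed.

Lemma valency0 : valency 0 = 0.
Proof. by have := card_atoms_below \bot; rewrite (level1_self HS) cardfs0 rank_bot. Qed.

(** Counts the pairs (atom, element of rank [k + 1] above it) below [y], the intervals above atoms
    being boolean. *)
Lemma level_bot_card y k : (k < rank y)%N ->
  (#|` level \bot y k.+1| * valency k.+1 = valency (rank y) * 'C((rank y).-1, k))%N.
Proof.
move=> ky; have := sum_level fin \bot y k.
rewrite (eq_big_seq (fun=> 'C((rank y).-1, k))) => [|c]; last first.
  rewrite in_atoms_below => /andP[cy /eqP rc].
  rewrite -subn1 -rc; apply: (small_boolean_level HS (n := rank y)) => //.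
  - by move=> ? ? x0 xy _; exact: (card_level1_upper HS HE).
  - exact: rank1_neq_bot.
  - by rewrite leq_subr.
rewrite [X in _ = X](eq_big_seq (fun=> valency k.+1)) => [|z]; last first.
  rewrite in_level => /and3P[_ _ /eqP rz].
  by rewrite card_atoms_below rz rank_bot.
rewrite !big_const_seq !count_predT !iter_addn_0 card_atoms_below.
by rewrite mulnC => ->; rewrite mulnC.
Qed.

Lemma leq_valency n : (n <= valency n)%N.
Proof.
case: n => [//|n]; have [y ry] := rank_exists n.+1.
have y0 : y != \bot by rewrite -(rank_gt0 fin gr) ry.
have : (0 < #|` level \bot y 1|)%N.
  by apply: (level_gt0 fin gr); rewrite ?le0x// rank_bot ry.
rewrite cardfs_gt0 => /fset0Pn[b by_].
rewrite -ry -card_atoms_below; apply: leq_trans (card_level1_gt HS HE by_).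
move: by_; rewrite in_atoms_below => /andP[by_ /eqP rb].
by rewrite (boolean_above_atom rb)// rb ry subn1.
Qed.

Lemma valency_mono n : (valency n <= valency n.+1)%N.
Proof.
have [y ry] := rank_exists n.+1.
have [|x [_ xy rx]] := level_exists fin gr (le0x y) (n := n).
  by rewrite rank_bot ry/=.
rewrite -ry -rx -!card_atoms_below; apply: fsubset_leq_card.
exact: level1_mono.
Qed.

Lemma valency1 : valency 1 = 1.
Proof.
have [y ry] := rank_exists 1; rewrite -ry -card_atoms_below.
by rewrite (card_level1_rank1 HS) ?le0x// rank_bot.
Qed.

Lemma valency2 : valency 2 = 2.
Proof.
have [y ry] := rank_exists 2; rewrite -{1}ry -card_atoms_below.
by rewrite (card_level1_rank2 HS HE) ?le0x// rank_bot.
Qed.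

(* Below the rank 3 element spanned by [p], [b] and [c] the atom [b] has two
   neighbours, and [p] and [c] are the only other atoms. *)
Lemma adjacent_trans p b c : valency 3 = 3 ->
  adjacent p b -> adjacent p c -> b != c -> adjacent b c.
Proof.
move=> v3 pb pc bc; have rz := rank_join_adjacent pb pc bc.
set z := (p `|` b) `|` (p `|` c) in rz.
have := pb; have := pc => /and3P[/eqP rp /eqP rc _] /and3P[_ /eqP rb _].
have bz : b <= z by rewrite (le_trans _ (leUl _ _))// leUr.
have cz : c <= z by rewrite (le_trans _ (leUr _ _))// leUr.
have /eqP nbE : neighbours \bot z b == level \bot z 1 `\ b.
  rewrite eqEfcard card_neighbours_atom// rz/=; apply/andP; split.
    apply/fsubsetP => t; rewrite mem_neighbours// in_fsetD1 in_atoms_below.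
    move=> /andP[-> bt]; rewrite eq_sym adjacent_neq//=.
    by case/and3P: bt.
  have := cardfsD1 b (level \bot z 1).
  by rewrite card_atoms_below rz v3 in_atoms_below bz rb add1n => -[<-].
have : c \in neighbours \bot z b.
  by rewrite nbE in_fsetD1 eq_sym bc in_atoms_below cz rc.
by rewrite mem_neighbours// => /andP[].
Qed.

Lemma neighbours_rank3 z r s t q : rank z = 3 -> s <= z -> t <= z -> q <= z ->
  adjacent r s -> adjacent r t -> adjacent r q -> r <= z -> s != t ->
  (q == s) || (q == t).
Proof.
move=> rz sz tz qz rs rt rq rz' st; apply: contraTT isT; rewrite negb_or => /andP[qs qt].
have rr : rank r = 1 by case/and3P: rs => /eqP.
have : (size [:: q; s; t] <= #|` neighbours \bot z r|)%N.
  apply: uniq_leq_size => [|u]; first by rewrite /= !inE negb_or qs qt st.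
  by rewrite 3!in_cons in_nil orbF mem_neighbours// => /or3P[] /eqP ->; apply/andP.
by rewrite card_neighbours_atom// rz.
Qed.

(** Each of the four atoms below the rank 3 element [z] has exactly two neighbours there. A triangle
    uses up both neighbours of its vertices and leaves none for the fourth atom [q]. *)
Lemma no_triangle p b c : valency 3 = 4 ->
  adjacent p b -> adjacent p c -> adjacent b c -> False.
Proof.
move=> v3 pb pc bc; have nbc := adjacent_neq bc.
have rz := rank_join_adjacent pb pc nbc.
set z := (p `|` b) `|` (p `|` c) in rz.
have := pb; have := pc => /and3P[/eqP rp /eqP rc _] /and3P[_ /eqP rb _].
have pz : p <= z by rewrite (le_trans _ (leUl _ _))// leUl.
have bz : b <= z by rewrite (le_trans _ (leUl _ _))// leUr.
have cz : c <= z by rewrite (le_trans _ (leUr _ _))// leUr.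
have [q qz] : exists q, q \in (level \bot z 1 `\` [fset p; b; c])%fset.
  apply/fset0Pn; rewrite -cardfs_gt0 cardfsD subn_gt0 card_atoms_below rz v3.
  apply: leq_ltn_trans (fsubset_leq_card (fsubsetIr _ _)) _.
  by rewrite -fsetUA cardfsU1 cardfs2; case: (_ \notin _); case: (_ != _).
move: qz; rewrite in_fsetD in_atoms_below !inE !negb_or.
move=> /andP[/andP[/andP[qp qb] qc] /andP[qz /eqP rq]].
have [r rqz] : exists r, r \in neighbours \bot z q.
  by apply/fset0Pn; rewrite -cardfs_gt0 card_neighbours_atom// rz.
move: rqz; rewrite mem_neighbours// => /andP[rz' qr].
have qrE : r \in [fset p; b; c].
  apply: contraTT isT; rewrite !inE !negb_or => /andP[/andP[rp' rb'] rc'].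
  have : (size [:: p; b; c; q; r] <= #|` level \bot z 1|)%N.
    apply: uniq_leq_size => [|u].
      rewrite /= !inE !negb_or nbc ![_ == q]eq_sym qp qb qc ![_ == r]eq_sym.
      by rewrite rp' rb' rc' (adjacent_neq pb) (adjacent_neq pc) eq_sym (adjacent_neq qr).
    rewrite 5!in_cons in_nil orbF in_atoms_below.
    have rr : rank r = 1 by case/and3P: qr => _ /eqP.
    by move=> /or4P[| | |/orP[]] /eqP ->; apply/andP; split=> //; exact/eqP.
  by rewrite card_atoms_below rz v3.
have key s t u : s <= z -> t <= z -> u <= z -> adjacent s t -> adjacent s u ->
    t != u -> adjacent q s -> (q == t) || (q == u).
  move=> sz tz uz st su tu qs.
  by apply: (@neighbours_rank3 z s t u q) => //; rewrite adjacent_sym.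
move: qrE; rewrite !inE => /orP[/orP[]|] /eqP rE; rewrite rE in qr.
- by have := key p b c pz bz cz pb pc nbc qr; rewrite (negbTE qb) (negbTE qc).
- have bp : adjacent b p by rewrite adjacent_sym.
  have := key b p c bz pz cz bp bc (adjacent_neq pc) qr.
  by rewrite (negbTE qp) (negbTE qc).
- have cp : adjacent c p by rewrite adjacent_sym.
  have cb : adjacent c b by rewrite adjacent_sym.
  have := key c p b cz pz bz cp cb (adjacent_neq pb) qr.
  by rewrite (negbTE qp) (negbTE qb).
Qed.

(* As adjacency is transitive, an atom and its neighbours below an element of
   rank [n] form a class of [n] elements. *)
Lemma valency_clique n : valency 3 = 3 -> (0 < n)%N ->
  valency n = n \/ (n.*2 <= valency n)%N.
Proof.
move=> v3 n0; have [y ry] := rank_exists n.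
have : (0 < #|` level \bot y 1|)%N.
  by apply: (level_gt0 fin gr); rewrite ?le0x// rank_bot ry subn0.
rewrite cardfs_gt0 => /fset0Pn[a ay].
pose cl b := b |` neighbours \bot y b.
have clsub b : b \in level \bot y 1 -> cl b `<=` level \bot y 1.
  move=> by_; apply/fsubsetP => t; rewrite in_fset1U => /predU1P[->//|].
  by rewrite in_neighbours => /andP[].
have cardcl b : b \in level \bot y 1 -> #|` cl b| = n.
  rewrite in_atoms_below => /andP[by_ /eqP rb].
  by rewrite cardfsU1 neighbours_irrefl// card_neighbours_atom// ry add1n prednK.
have [clE|] := eqVneq (cl a) (level \bot y 1).
  by left; rewrite -{1}ry -card_atoms_below -clE cardcl.
rewrite eqEfsubset clsub//= => /fsubsetPn[c cy ca]; right.
have disj : [disjoint cl a & cl c]%fset.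
  have [] := (ay, cy); rewrite !in_atoms_below => /andP[ay' /eqP ra] /andP[cy' /eqP rc].
  move: ca; rewrite in_fset1U negb_or mem_neighbours// cy'/= => /andP[ca nca].
  apply/fdisjointP => t; rewrite !in_fset1U negb_or !mem_neighbours// negb_and.
  move=> /predU1P[->|/andP[-> ta]].
    by rewrite eq_sym ca adjacent_sym nca orbT.
  apply/andP; split; first by apply: contraNneq nca => <-.
  apply: contra nca => ct; apply: (@adjacent_trans t) => //.
  - by rewrite adjacent_sym.
  - by rewrite adjacent_sym.
  - by rewrite eq_sym.
rewrite -addnn -{1}(cardcl a ay) -{1}(cardcl c cy) -ry -card_atoms_below.
rewrite -cardfsUI; move: disj; rewrite -fsetI_eq0 => /eqP ->.
rewrite cardfs0 addn0; apply: fsubset_leq_card.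
by rewrite fsubUset !clsub.
Qed.

(* The edges leaving a facet end in distinct vertices. *)
Lemma valency_double n : valency 3 = 4 -> (0 < n)%N ->
  ((valency n).*2 <= valency n.+1)%N.
Proof.
move=> v3 n0; have [y ry] := rank_exists n.+1.
have [|x [_ xy rx]] := level_exists fin gr (le0x y) (n := n).
  by rewrite rank_bot ry/=.
have out b : exists c, b \in level \bot x 1 ->
    [/\ c <= y, ~~ (c <= x) & adjacent b c].
  have [|bN] := boolP (b \in level \bot x 1); last by exists b.
  rewrite in_atoms_below => /andP[bx /eqP rb].
  have : ~~ (neighbours \bot y b `<=` neighbours \bot x b).
    apply/negP => /fsubset_leq_card.
    by rewrite !card_neighbours_atom// ?(le_trans bx)// rx ry; lia.
  move=> /fsubsetPn[c]; rewrite !mem_neighbours// => /andP[cy bc].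
  by rewrite bc andbT => cx; exists c.
have [f fP] := choice out.
have finj : {in level \bot x 1 &, injective f}.
  move=> b b' bx bx' fE; apply: contraTeq isT => bb'.
  have [fy fx bq] := fP b bx; have [_ _ bq'] := fP b' bx'.
  rewrite -fE adjacent_sym in bq'; rewrite adjacent_sym in bq.
  set q := f b in fy fx bq bq'.
  have rz := rank_join_adjacent bq bq' bb'.
  set z := (q `|` b) `|` (q `|` b') in rz.
  have [] := (bx, bx'); rewrite !in_atoms_below.
  move=> /andP[{}bx /eqP rb] /andP[{}bx' /eqP rb'].
  have bz : b <= z by rewrite (le_trans _ (leUl _ _))// leUr.
  have bz' : b' <= z by rewrite (le_trans _ (leUr _ _))// leUr.
  have qz : q <= z by rewrite (le_trans _ (leUl _ _))// leUl.
  (* Since [q] is not below [x], this meet has rank at most 2; it lies above [b] and [b'], which are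
     therefore adjacent and form a triangle with [q]. *)
  have xz : x `&` z < z.
    rewrite lt_neqAle leIr andbT; apply: contraNneq fx => xzE.
    by rewrite (le_trans qz)// -xzE leIl.
  have := rank_lt xz; rewrite rz ltnS => rxz.
  have bb'x : b `|` b' <= x `&` z by rewrite leUx !lexI bx bx' bz bz'.
  have rbb' := rank_le bb'x.
  have := @rank_join _ _ HS b b' \bot; rewrite !in_atoms_below leUl leUr rb rb' bb' rank_bot.
  move=> /(_ isT isT isT) rbb2.
  exfalso; apply: (no_triangle v3 bq bq').
  by rewrite /adjacent rb rb' !eqxx/= eqn_leq (leq_trans rbb').
rewrite -addnn -ry -rx -!card_atoms_below.
rewrite -{2}(card_in_imfset imfset_key finj) -cardfsUI.
rewrite (_ : (_ `&` _)%fset = fset0) ?cardfs0 ?addn0; last first.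
  apply/fsetP => t; rewrite in_fsetI inE; apply/negP => /andP[tx].
  move=> /imfsetP[b /= bx tE]; have [_ + _] := fP b bx.
  by move: tx; rewrite in_atoms_below tE => /andP[->].
apply: fsubset_leq_card; rewrite fsubUset level1_mono//=.
apply/fsubsetP => _ /imfsetP[b /= bx ->]; have [fy _ /and3P[_ rf _]] := fP b bx.
by rewrite in_atoms_below fy.
Qed.

End Atoms.

(** * The number of atoms below an element *)

Section SelfInverse.
Local Open Scope ring_scope.
Implicit Types (e p q : nat -> rat) (m n : nat).

(** At an odd [m] the relation determines [p m] from the smaller indices; at an even [m] the term
    [p m] cancels, so each even index carries an unknown. *)
Definition self_inverse p := forall m,
  \sum_(j < m.+1) (-1) ^+ j * 'C(m, j)%:R * p j = p m.

Lemma self_inverseB p q : self_inverse p -> self_inverse q ->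
  self_inverse (fun j => p j - q j).
Proof.
by move=> Hp Hq m; under eq_bigr do rewrite mulrBr; rewrite sumrB Hp Hq.
Qed.

(** The solution for cubes, [C (j + 1) = 2 ^ j], by expanding [(1 - 1/2) ^ m]. *)
Lemma self_inverse_half : self_inverse (fun j => 2^-1 ^+ j).
Proof.
move=> m; transitivity ((1 - 2^-1) ^+ m : rat); last by congr (_ ^+ _); lra.
rewrite exprBn; apply: eq_bigr => j _.
by rewrite expr1n mulr1 -[RHS]mulr_natr mulrAC.
Qed.

(** The solution for simplices, [C (j + 1) = j + 1]: multiplied by [m + 1], the sum becomes the
    alternating sum of row [m + 1] of Pascal's triangle without its first term. *)
Lemma self_inverse_inv : self_inverse (fun j => j.+1%:R^-1).
Proof.
move=> m; apply: (@mulfI _ m.+1%:R); first by rewrite pnatr_eq0.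
rewrite mulfV ?pnatr_eq0// big_distrr/=.
have := alternating_binomial_sum rat m; rewrite big_ord_recl/= bin0 expr0 mulr1.
move/eqP; rewrite addr_eq0 => /eqP e.
rewrite [RHS]e -sumrN; apply: eq_bigr => j _.
rewrite /bump/= add1n exprS mulN1r mulNr opprK.
rewrite -mulrA mulrCA; congr (_ * _).
have := mul_bin_diag m.+1 j => /(congr1 (fun n => n%:R : rat)); rewrite /= !natrM.
by move=> e'; rewrite mulrA e' mulrAC mulfV ?pnatr_eq0// mul1r.
Qed.

Lemma bin3E n : (6 * 'C(n.+3, 3) = n.+3 * n.+2 * n.+1)%N.
Proof.
have := mul_bin_diag n.+3 2; have := mul_bin_diag n.+2 1; rewrite /= bin1.
by move=> e1 e2; rewrite -mulnA e1 mulnCA e2; lia.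
Qed.

Lemma bin2E n : (2 * 'C(n.+2, 2) = n.+2 * n.+1)%N.
Proof. by have := mul_bin_diag n.+2 1; rewrite /= bin1 => ->. Qed.

Section Vanishing.
Context (e : nat -> rat) (He : self_inverse e) (m : nat) (me : ~~ odd m)
  (e0 : forall j, (j < m)%N -> e j = 0).

Let sign k : (-1) ^+ (m + k) = (-1) ^+ k :> rat.
Proof. by rewrite exprD -[(-1) ^+ m]signr_odd (negbTE me) mul1r. Qed.

Let sum0 (n : nat) :
  \sum_(j < m) (-1) ^+ j * 'C(n, j)%:R * e j = 0.
Proof. by rewrite big1// => j _; rewrite e0// mulr0. Qed.

(** To be applied to the difference of two solutions that agree below the even index [m]; this is
    the relation at [m + 1], and the next lemma is the one at [m + 3]. *)
Lemma self_inverse_vanish1 : 2 * e m.+1 = m.+1%:R * e m.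
Proof.
have := He m.+1; rewrite !big_ord_recr/= sum0 add0r binSn binn.
rewrite -[in (-1) ^+ m](addn0 m) -[in (-1) ^+ m.+1](addn1 m) !sign => h.
by rewrite mulrDl mul1r -{1}h expr0 expr1; ring.
Qed.

Lemma self_inverse_vanish3 : 2 * e m.+3 =
  'C(m.+3, 3)%:R * e m - 'C(m.+3, 2)%:R * e m.+1 + m.+3%:R * e m.+2.
Proof.
have := He m.+3; rewrite !big_ord_recr/= sum0 add0r binn binSn.
have -> : 'C(m.+3, m) = 'C(m.+3, 3) by rewrite -bin_sub; [congr 'C(_, _)|]; lia.
have -> : 'C(m.+3, m.+1) = 'C(m.+3, 2) by rewrite -bin_sub; [congr 'C(_, _)|]; lia.
rewrite -[in (-1) ^+ m](addn0 m) -[in (-1) ^+ m.+1](addn1 m).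
rewrite -[in (-1) ^+ m.+2](addn2 m) -[in (-1) ^+ m.+3](addn3 m) !sign => h.
by rewrite mulrDl mul1r -{1}h expr0 expr1; ring.
Qed.

End Vanishing.

End SelfInverse.

(* With [p j = 2^-j + e j] this excludes that an element of rank [m + 1] has
   more than [2 * m] coatoms. *)
Lemma cube_facets_bound (m x e1 e2 e3 b2 b3 q g : rat) :
  (2 <= m -> 0 < q -> 2 * m + 1 <= g -> (x + q) * g = 2 * m * q ->
  2 * e1 = (m + 1) * x -> 2 * e3 = b3 * x - b2 * e1 + (m + 3) * e2 ->
  6 * b3 = (m + 3) * (m + 2) * (m + 1) -> 2 * b2 = (m + 3) * (m + 2) ->
  2 * e3 <= e2 -> - q < 4 * e2 -> False)%R.
Proof.
move=> m2 q0 gm xg he1 he3 hb3 hb2 e32 e2q.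
have h24 : (24 * e3 = 12 * (m + 3) * e2 - (m + 1) * (m + 2) * (m + 3) * x)%R.
  transitivity (12 * (2 * e3))%R; first by ring.
  rewrite he3; transitivity (2 * (6 * b3) * x - 3 * (2 * b2) * (2 * e1) +
    12 * (m + 3) * e2)%R; first by ring.
  by rewrite hb3 hb2 he1; ring.
have h12 : ((m + 2) * (12 * e2) <= (m + 2) * ((m + 1) * (m + 3) * x))%R.
  have -> : ((m + 2) * ((m + 1) * (m + 3) * x) = 12 * (m + 3) * e2 - 24 * e3)%R.
    by rewrite h24; ring.
  by lra.
have {}h12 : (12 * e2 <= (m + 1) * (m + 3) * x)%R.
  by move: h12; rewrite ler_pM2l//; lra.
(* Both bounds on [e2] give [- 3 q < 12 e2 <= (m + 1) (m + 3) x]. Substituting [x g = (2 m - g) q]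
   and dividing by [q] then leaves an inequality in [m] and [g] alone. *)
have h3 : (0 < g * (3 * q + (m + 1) * (m + 3) * x))%R by apply: mulr_gt0; lra.
have {}h3 : (0 < q * (3 * g - (m + 1) * (m + 3) * (g - 2 * m)))%R.
  rewrite (_ : (q * _ = g * (3 * q + (m + 1) * (m + 3) * x))%R)//.
  transitivity (3 * q * g + (m + 1) * (m + 3) * (2 * m * q - q * g))%R; first by ring.
  by rewrite -xg; ring.
have {}h3 : (0 < 3 * g - (m + 1) * (m + 3) * (g - 2 * m))%R by rewrite -(pmulr_rgt0 _ q0).
(* The inequality says [g (m^2 + 4 m) < 2 m (m + 1) (m + 3)]; for [g >= 2 m + 1] it implies
   [m^2 < 2 m], against [m >= 2]. *)
by nra.
Qed.

(** * The two possible sequences of atom numbers *)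

Section Valency.
Context {d : Order.disp_t} {L : bLatticeType d}.
Context (HS : sheffer_poset L) (HE : eulerian L).
Let fin := sheffer_locally_finite HS.
Let gr := sheffer_graded HS.
Let C n := @valency _ L n.
Let p (j : nat) : rat := ((C j.+1)%:R^-1)%R.

Let C_gt0 n : (0 < C n.+1)%N.
Proof. exact: leq_trans (leq_valency HS HE n.+1). Qed.

Let C_neq0 n : ((C n.+1)%:R != 0 :> rat)%R.
Proof. by rewrite pnatr_eq0 -lt0n. Qed.

Let p_gt0 n : (0 < p n)%R.
Proof. by rewrite invr_gt0 ltr0n. Qed.

Let p_noninc n : (p n.+1 <= p n)%R.
Proof. by rewrite lef_pV2 ?posrE ?ltr0n// ler_nat (valency_mono HS). Qed.

(** The Euler relation below an element of rank [m + 1], divided by [C (m + 1)]. *)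
Lemma valency_self_inverse : self_inverse p.
Proof.
move=> m; have [y ry] := rank_exists HS m.+1.
have y0 : \bot < y by rewrite lt0x -(rank_gt0 fin gr) ry.
have := euler_level HS HE y0; rewrite (rank_bot fin gr) subn0 ry big_ord_recl/=.
rewrite level0 ?le0x// cardfs1 expr0 mulr1 => /eqP; rewrite addr_eq0 => /eqP e.
apply: (mulfI (C_neq0 m)); rewrite mulfV// [RHS]e -sumrN big_distrr/=.
apply: eq_bigr => j _; rewrite /bump/= add1n exprS !mulN1r mulNr opprK.
have jy : (j < rank y)%N by rewrite ry.
have := level_bot_card HS HE jy; rewrite ry/= => /(congr1 (fun n => n%:R : rat)%R).
rewrite !natrM => e'; rewrite -mulrA mulrCA; congr (_ * _)%R.
by rewrite mulrA -[((C _)%:R * _)%R]e' mulfK.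
Qed.

Lemma valency3 : C 3 = 3 \/ C 3 = 4.
Proof.
have := valency_self_inverse 3; have := valency_self_inverse 5.
have e0 : p 0 = 1%R by rewrite /p /C (valency1 HS) invr1.
have e1 : p 1 = (2^-1)%R by rewrite /p /C (valency2 HS HE).
rewrite !big_ord_recr !big_ord0/= e0 e1.
rewrite -[in ((-1) ^+ 5)%R]signr_odd -[in ((-1) ^+ 4)%R]signr_odd.
rewrite -[in ((-1) ^+ 3)%R]signr_odd -[in ((-1) ^+ 2)%R]signr_odd /= expr1 expr0.
rewrite !binS !bin0 !bin0n/= => h5 h3.
have := p_gt0 3; have := p_gt0 4; have := p_noninc 4 => p5 p4 p3.
have C6 : (C 3 < 6)%N.
  (* The relation at 3 reads [2 p 3 = 3 p 2 - 1/2], and [p 3] is positive. *)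
  have : (6^-1 < p 2 :> rat)%R by clear h5 p5 p4; lra.
  by rewrite ltf_pV2 ?posrE ?ltr0n// ltr_nat.
have C3 : (2 < C 3)%N := leq_valency HS HE 3.
(* If [C 3 = 5] then [p 3 = 1/20], and the relation at 5 becomes [2 p 5 = 5 p 4], although [p] is
   positive and nonincreasing. *)
have : C 3 != 5.
  apply/eqP => C5; have p2 : p 2 = (5^-1)%R by rewrite /p C5.
  by lra.
by case: (C 3) C6 C3 => [|[|[|[|[|[|]]]]]]//; auto.
Qed.

Let sub_vanish (c : nat -> nat) m :
  (forall n, (n < m)%N -> C n.+1 = c n) ->
  forall j, (j < m)%N -> (p j - (c j)%:R^-1 = 0)%R.
Proof. by move=> Hm j jm; rewrite /p Hm ?subrr. Qed.

(** Values are settled in pairs, since the one at [m + 1] follows from the unknown at the even index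
    [m]. *)
Let even_induction (c : nat -> nat) : c 0 = 1 -> c 1 = 2 ->
  (forall m, ~~ odd m -> (1 < m)%N -> (forall n, (n < m)%N -> C n.+1 = c n) ->
    C m.+1 = c m /\ C m.+2 = c m.+1) ->
  forall n, C n.+1 = c n.
Proof.
move=> c0 c1 step n; suff HH N : forall n, (n < N.*2.+2)%N -> C n.+1 = c n.
  by apply: (HH n); rewrite -addnn; lia.
elim: N => [|N IH] {}n.
  case: n => [|[|//]] _; first by rewrite c0; exact: valency1 HS.
  by rewrite c1; exact: valency2 HS HE.
have Nodd : ~~ odd N.*2.+2 by rewrite /= negbK odd_double.
have [e1 e2] := step N.*2.+2 Nodd isT IH.
rewrite doubleS ltnS leq_eqVlt => /predU1P[->//|].
by rewrite ltnS leq_eqVlt => /predU1P[->//|]; exact: IH.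
Qed.

Lemma valency_simplex n : C 3 = 3 -> C n.+1 = n.+1.
Proof.
move=> C3; apply: (even_induction (c := S)) => // m modd m1 Hm.
pose e (j : nat) : rat := (p j - j.+1%:R^-1)%R.
have He : self_inverse e.
  exact: self_inverseB valency_self_inverse self_inverse_inv.
have e0 := self_inverse_vanish1 He modd (sub_vanish Hm).
have inv1 : (m.+1%:R * m.+1%:R^-1 = 1 :> rat)%R by rewrite mulfV// pnatr_eq0.
have C1 : C m.+1 = m.+1.
  (* If [C (m + 1) >= 2 (m + 1)], then [(m + 1) p m <= 1/2], and [self_inverse_vanish1] gives
     [p (m + 1) <= 1 / (m + 2) - 1/4 <= 0]. *)
  have [//|Cm] := valency_clique HS HE C3 (ltn0Sn m).
  have h : (m.+1%:R * p m <= 2^-1)%R.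
    rewrite -ler_pdivlMl ?ltr0n// -invfM lef_pV2 ?posrE ?mulr_gt0 ?ltr0n//.
    by rewrite -natrM ler_nat muln2.
  have pm1 := p_gt0 m.+1.
  have i2 : (m.+2%:R^-1 <= 4^-1 :> rat)%R.
    by rewrite lef_pV2 ?posrE ?ltr0n// ler_nat.
  have arith (u v w : rat) : (u <= 2^-1 -> 0 < v -> w <= 4^-1 ->
    2 * v - 2 * w = u - 1 -> False)%R by lra.
  by case: (arith _ _ _ h pm1 i2); move: e0; rewrite /e !mulrBr inv1.
split=> //; apply/eqP; rewrite -(eqr_nat rat); apply/eqP/invr_inj.
have em : e m = 0%R by rewrite /e /p C1 subrr.
move: e0; rewrite em mulr0 => /eqP; rewrite mulf_eq0 pnatr_eq0/= subr_eq0.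
by move/eqP.
Qed.

Lemma valency_cube n : C 3 = 4 -> C n.+1 = (2 ^ n)%N.
Proof.
move=> C3; apply: (even_induction (c := fun n => 2 ^ n)%N) => // m modd m1 Hm.
pose e (j : nat) : rat := (p j - 2^-1 ^+ j)%R.
have He : self_inverse e.
  exact: self_inverseB valency_self_inverse self_inverse_half.
have e0 j : (j < m)%N -> (e j = 0)%R.
  by move=> jm; rewrite -(sub_vanish Hm jm) /e natrX exprVn.
have v1 := self_inverse_vanish1 He modd e0.
have v3 := self_inverse_vanish3 He modd e0.
have b3 := congr1 (fun n => n%:R : rat)%R (bin3E m).
have b2 := congr1 (fun n => n%:R : rat)%R (bin2E m.+1).
have m2 : (2 <= m%:R :> rat)%R by rewrite ler_nat.
have pow j : (0 < 2^-1 ^+ j :> rat)%R by rewrite exprn_gt0.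
have double j : (2 * p j.+1 <= p j)%R.
  rewrite -ler_pdivlMl// -invfM lef_pV2 ?posrE ?mulr_gt0 ?ltr0n//.
  by rewrite -natrM ler_nat mul2n (valency_double HS HE).
have Cm : C m = (2 ^ m.-1)%N by rewrite -[in LHS](prednK (ltnW m1)) Hm ?prednK// ltnW.
have [y ry] := rank_exists HS m.+1.
(* Level [m] below [y] consists of its coatoms, [g] in number. Then [gM] says
   [g 2^(m-1) = C (m + 1) m], so the goal [C (m + 1) = 2^m] amounts to [g = 2 m]. *)
have my : (m.-1 < rank y)%N by rewrite ry; lia.
have := level_bot_card HS HE my; rewrite ry/= (prednK (ltnW m1)) -/(C m) Cm.
set g := #|` _|; rewrite -/(C m.+1).
rewrite -[in 'C(_, _)](prednK (ltnW m1)) binSn (prednK (ltnW m1)) => gM.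
have CM : (2 ^ m <= C m.+1)%N.
  have := valency_double HS HE C3 (ltnW m1); rewrite -/(C m) Cm.
  by rewrite -mul2n -expnS prednK// ltnW.
have pow2 : (2 ^ m = 2 * 2 ^ m.-1)%N by rewrite -expnS prednK// ltnW.
have gm : g = (2 * m)%N.
  apply/eqP; rewrite eqn_leq; apply/andP; split; last first.
    rewrite -(leq_pmul2r (_ : 0 < 2 ^ m.-1)%N) ?expn_gt0// gM mulnAC -pow2.
    by rewrite leq_mul2r CM orbT.
  (* More than [2 m] coatoms contradict [cube_facets_bound]; its bounds on [e (m + 3)] and
     [e (m + 2)] come from [double] and from the positivity of [p]. *)
  rewrite leqNgt; apply/negP => gm.
  pose q : rat := (2^-1 ^+ m)%R.
  have eE k : e (m + k) = (p (m + k) - q * 2^-1 ^+ k)%R by rewrite /e exprD.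
  have c1 : (m%:R + 1 = m.+1%:R :> rat)%R by rewrite natr1.
  have c2 : (m%:R + 2 = m.+2%:R :> rat)%R by rewrite -[m.+2]addn2 natrD.
  have c3 : (m%:R + 3 = m.+3%:R :> rat)%R by rewrite -[m.+3]addn3 natrD.
  apply: (@cube_facets_bound m%:R (e m) (e m.+1) (e m.+2) (e m.+3)
    'C(m.+3, 2)%:R 'C(m.+3, 3)%:R q g%:R) => //.
  - exact: pow.
  - by rewrite -natrM natr1 ler_nat.
  - rewrite /e subrK /p /q exprVn -natrX.
    apply: (mulfI (C_neq0 m)); rewrite mulrA mulfV// mul1r.
    apply: (@mulIf _ (2 ^ m)%:R); first by rewrite pnatr_eq0 -lt0n expn_gt0.
    rewrite mulrA mulfVK ?pnatr_eq0 -?lt0n ?expn_gt0//.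
    rewrite -!natrM; congr (_%:R)%R.
    by rewrite pow2 mulnCA gM mulnCA.
  - by rewrite c1.
  - by rewrite c3.
  - by rewrite c1 c2 c3 -!natrM bin3E.
  - by rewrite c2 c3 -!natrM bin2E.
  - have arith (u v w : rat) : (2 * u <= v ->
      2 * (u - w * 2^-1 ^+ 3) <= v - w * 2^-1 ^+ 2)%R by rewrite !exprS; lra.
    by have := double m.+2; rewrite -(addn3 m) -(addn2 m) !eE; exact: arith.
  - have arith (u w : rat) : (0 < u -> - w < 4 * (u - w * 2^-1 ^+ 2))%R.
      by rewrite !exprS; lra.
    by have := p_gt0 m.+2; rewrite -(addn2 m) eE; exact: arith.
have C1 : C m.+1 = (2 ^ m)%N.
  by apply/eqP; rewrite -(eqn_pmul2r (ltnW m1)) -gM gm pow2 mulnAC.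
split=> //; apply/eqP; rewrite -(eqr_nat rat); apply/eqP/invr_inj.
have em : e m = 0%R by rewrite /e /p C1 natrX exprVn subrr.
move: v1; rewrite em mulr0 => /eqP; rewrite mulf_eq0 pnatr_eq0/= subr_eq0.
by move/eqP; rewrite natrX -exprVn.
Qed.

End Valency.

(** * Coordinates in the cubical case *)

Section SymmetricDifference.
Context {T : choiceType}.
Implicit Types A B : {fset T}.

Definition symd A B : {fset T} := ((A `\` B) `|` (B `\` A))%fset.

Lemma in_symd A B x : (x \in symd A B) = (x \in A) (+) (x \in B).
Proof. by rewrite in_fsetU !in_fsetD; case: (x \in A); case: (x \in B). Qed.

Lemma symdK A B : symd A (symd A B) = B.
Proof. by apply/fsetP => x; rewrite !in_symd addKb. Qed.

Lemma symdC A B : symd A B = symd B A.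
Proof. by apply/fsetP => x; rewrite !in_symd addbC. Qed.

Lemma symd_eq0 A B : symd A B = fset0 -> A = B.
Proof.
move=> e; apply/fsetP => x; have := in_symd A B x; rewrite e inE.
by case: (x \in A); case: (x \in B).
Qed.

Lemma symd1_eq u v w x A :
  symd [fset v] (symd [fset u] A) = symd [fset w] (symd [fset x] A) ->
  forall t, (t == v) (+) (t == u) = (t == w) (+) (t == x).
Proof.
move=> /fsetP e t; have := e t.
by rewrite !in_symd !in_fset1 !addbA => /addIb.
Qed.

Lemma symdD1 A B x : x \in symd A B ->
  symd (symd [fset x] A) B = symd A B `\ x.
Proof.
move=> xAB; apply/fsetP => t; rewrite in_fsetD1 !in_symd in_fset1 -addbA.
by have [->|//] := eqVneq t x; move: xAB; rewrite in_symd => ->.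
Qed.

Lemma fset_pred A U : A `<=` U -> (#|` U| <= #|` A|.+1)%N -> A != U ->
  exists2 x, x \in U & A = U `\ x.
Proof.
move=> AU cU; rewrite eqEfcard AU/= -ltnNge => cA.
have /cardfs1P[x xE] : #|` (U `\` A)%fset| == 1%N by rewrite cardfsDS//; apply/eqP; lia.
have : x \in (U `\` A)%fset by rewrite xE inE.
rewrite in_fsetD => /andP[xA xU]; exists x => //.
apply/fsetP => t; have := congr1 (fun B : {fset T} => t \in B) xE.
rewrite in_fsetD1 in_fsetD in_fset1 => e; have := fsubsetP AU t.
by case: (t \in A) e => [/= <- ->//|]; case: (t == x) => //= ->.
Qed.

End SymmetricDifference.

Local Opaque symd.

Section Coordinates.
Context {d : Order.disp_t} {L : bLatticeType d}.
Context (HS : sheffer_poset L) (HE : eulerian L).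
Context (C3 : @valency _ L 3 = 4).
Implicit Types a b c p q x y z : L.
Let fin := sheffer_locally_finite HS.
Let gr := sheffer_graded HS.
Let rank_le := rank_le fin gr.
Let rank_bot := rank_bot fin gr.
Let boolean := boolean_above_atom HS HE.
Let C n : @valency _ L n.+1 = (2 ^ n)%N := valency_cube HS HE n C3.

(* The coordinates of the vertex [b] of the cube with respect to the origin
   [a], as the set of directions in which [a] and [b] differ. *)
Definition coords a b : {fset L} := level a (a `|` b) 1.

Lemma in_level_atom a z x : rank a = 1 ->
  (x \in level a z 1) = [&& a <= x, x <= z & rank x == 2].
Proof. by move=> ra; rewrite (in_level fin) ra. Qed.

Lemma coordsP a b x : rank a = 1 -> x \in coords a b -> a <= x /\ rank x = 2.
Proof. by move=> ra; rewrite in_level_atom// => /and3P[-> _ /eqP]. Qed.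

Lemma coords_sub a b z : rank a = 1 -> a <= z ->
  (coords a b `<=` level a z 1) = (b <= z).
Proof.
move=> ra az; rewrite (boolean_level1_sub HS (boolean ra)) ?leUl//.
by rewrite leUx az.
Qed.

Lemma card_level_atom a z : rank a = 1 -> a <= z ->
  #|` level a z 1| = (rank z).-1.
Proof. by move=> ra az; rewrite (boolean ra)// ra subn1. Qed.

Lemma coords_adjacent_bot b c : adjacent b c -> coords b c = [fset b `|` c].
Proof.
move=> /and3P[/eqP rb _ /eqP rbc].
by have := level_top fin gr (leUl b c); rewrite rb rbc.
Qed.

(* The atoms below the element with coordinates [S] have coordinates in the
   powerset of [S], and there are as many atoms as subsets. *)
Lemma coords_unique a (S : {fset L}) : rank a = 1 ->
  {in S, forall s, a <= s /\ rank s = 2} ->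
  exists2 b, rank b = 1 /\ coords a b = S &
    forall b', rank b' = 1 -> coords a b' = S -> b' = b.
Proof.
move=> ra; move Sn : #|` S| => n; elim/ltn_ind: n => n IH in S Sn * => SP.
have [s /SP[]|z az zS] := boolean_level1_onto HS (boolean ra) (S := S).
  by rewrite ra.
have rz : rank z = n.+1.
  have := card_level_atom ra az; rewrite zS Sn => ->.
  by rewrite prednK// (leq_trans _ (rank_le az))// ra.
pose I T := [fset b in level \bot z 1 | coords a b == T].
have memI T b : T `<=` S -> (b \in I T) = (rank b == 1%N) && (coords a b == T).
  move=> TS; rewrite in_fset_cond in_atoms_below// -(coords_sub b ra az) zS.
  by case: (coords a b =P T) => [->|]; rewrite ?andbF// TS.
have cardI T : T `<=` S -> T != S -> #|` I T| = 1.
  move=> TS TNS; have [||b [rb bT] bU] := IH #|` T| _ T erefl.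
  - by rewrite -Sn; apply: fproper_ltn_card; rewrite fproperEneq TNS.
  - by move=> t /(fsubsetP TS); exact: SP.
  suff -> : I T = [fset b] by rewrite cardfs1.
  apply/fsetP => c; rewrite memI// in_fset1.
  by apply/andP/eqP => [[/eqP rc /eqP cT]|->]; [exact: bU|rewrite rb bT].
(* Both sides are [2 ^ n]. By induction each proper subset contributes one atom, so exactly one is
   left for [S]. *)
have : (\sum_(T <- fpowerset S) #|` I T| = \sum_(T <- fpowerset S) 1)%N.
  rewrite -card_fset_sum1 card_fpowerset Sn -C -rz -card_atoms_below//.
  under eq_bigr do rewrite card_fset_cond.
  rewrite exchange_big/= card_fset_sum1; apply: eq_big_seq => b.
  rewrite in_atoms_below// => /andP[bz /eqP rb].
  rewrite (big_fsetD1 (coords a b))/=; last by rewrite fpowersetE -zS coords_sub.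
  rewrite eqxx big1_fset// => T; rewrite in_fsetD1 => /andP[TN _] _.
  by rewrite eq_sym (negbTE TN).
have SS : S \in fpowerset S by rewrite fpowersetE fsubset_refl.
rewrite (big_fsetD1 S)//= [RHS](big_fsetD1 S)//=.
rewrite [X in (_ + X)%N = _](eq_big_seq (fun=> 1%N)) => [|T]; last first.
  by rewrite in_fsetD1 fpowersetE => /andP[TN TS]; exact: cardI.
move=> /eqP; rewrite eqn_add2r => /cardfs1P[b bE].
have memIS c : (rank c == 1%N) && (coords a c == S) = (c == b).
  by rewrite -memI ?fsubset_refl// bE in_fset1.
have := memIS b; rewrite eqxx => /andP[/eqP rb /eqP bS]; exists b => // c rc cS.
by apply/eqP; rewrite -memIS rc cS !eqxx.
Qed.

Lemma coords_inj a b c : rank a = 1 -> rank b = 1 -> rank c = 1 ->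
  coords a b = coords a c -> b = c.
Proof.
move=> ra rb rc bc; have [e _ eU] := coords_unique ra (fun x => @coordsP a b x ra).
by rewrite (eU b)// (eU c)// -bc.
Qed.

(** In the boolean part above [b], joining the edge [b]|[c] to [a]|[b] raises the rank by at most
    one. *)
Lemma card_coords_adjacent a b c z : rank a = 1 -> adjacent b c -> a <= z ->
  z <= a `|` (b `|` c) -> (#|` level a z 1| <= #|` coords a b|.+1)%N.
Proof.
move=> ra bc az zabc; have [/eqP rb /eqP rc /eqP rbc] := and3P bc.
rewrite !card_level_atom ?leUl//.
have := boolean_rank_join HS (boolean rb) (leUr b a) (leUl b c).
rewrite rb rbc => /(_ erefl) rw.
have zw : z <= (a `|` b) `|` (b `|` c).
  by rewrite (le_trans zabc)// leUx leUr (le_trans _ (leUl _ _))// leUl.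
have := rank_le zw; have := rank_le (leUl a b); rewrite ra; lia.
Qed.

(** Each neighbour of [b] below [a]|[b] has the coordinates of [b] with one removed. There are as
    many such neighbours as coordinates, so every removal occurs. *)
Lemma coords_down a b x : rank a = 1 -> rank b = 1 -> x \in coords a b ->
  exists2 c, adjacent b c & coords a c = coords a b `\ x.
Proof.
move=> ra rb xb; set z := a `|` b.
have az : a <= z by exact: leUl.
have bz : b <= z by exact: leUr.
have UB : coords a b `\ x \in (fun x => coords a b `\ x) @` coords a b.
  by apply/imfsetP; exists x.
have nbP c : c \in neighbours \bot z b -> c <= z /\ adjacent b c.
  by rewrite (mem_neighbours HS)// => /andP[].
have [c cz ->] : exists2 c, c \in neighbours \bot z b &
    coords a b `\ x = coords a c.
  apply: (@fset_inj_onto L {fset L} (coords a) (neighbours \bot z b) _ _ _ _ _ UB).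
  - move=> c /nbP[cz bc]; have [_ /eqP rc _] := and3P bc.
    have [|||y yU ->] := @fset_pred _ (coords a c) (coords a b).
    + by rewrite coords_sub.
    + apply: (@card_coords_adjacent a c b z) => //; first by rewrite adjacent_sym.
      by rewrite /z leUx leUl (le_trans _ (leUr _ _))// leUr.
    + apply/eqP => /(coords_inj ra rc rb) cb.
      by have := adjacent_neq bc; rewrite cb eqxx.
    + by apply/imfsetP; exists y.
  - move=> c c' /nbP[_ /and3P[_ /eqP rc _]] /nbP[_ /and3P[_ /eqP rc' _]].
    exact: coords_inj.
  - rewrite (card_neighbours_atom HS HE)//.
    by rewrite (leq_trans (leq_imfset_card _ _ _))// -(card_level_atom ra az).
by have [_ bc] := nbP c cz; exists c.
Qed.

(** Both coordinate sets miss at most one element of [U]. If each missed one, the atom with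
    coordinates [U] would be adjacent to [b] and [c] by [coords_down], a triangle. *)
Lemma coords_adjacent a b c : rank a = 1 -> adjacent b c ->
  exists2 x, a <= x /\ rank x = 2 & coords a c = symd [fset x] (coords a b).
Proof.
move=> ra bc; have [/eqP rb /eqP rc _] := and3P bc.
have cb : adjacent c b by rewrite adjacent_sym.
set w := a `|` (b `|` c); set U := level a w 1.
have aw : a <= w by exact: leUl.
have subb : coords a b `<=` U.
  by rewrite coords_sub// (le_trans _ (leUr _ _))// leUl.
have subc : coords a c `<=` U.
  by rewrite coords_sub// (le_trans _ (leUr _ _))// leUr.
have cardb : (#|` U| <= #|` coords a b|.+1)%N
  by exact: (card_coords_adjacent ra bc aw (lexx w)).
have cardc : (#|` U| <= #|` coords a c|.+1)%N.
  by apply: (card_coords_adjacent ra cb aw); rewrite (joinC c b).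
have UP x : x \in U -> a <= x /\ rank x = 2.
  by rewrite in_level_atom// => /and3P[-> _ /eqP].
have neq : coords a b != coords a c.
  apply: contraTneq bc => /(coords_inj ra rb rc) ->.
  by apply/negP => /adjacent_neq; rewrite eqxx.
have flip S x : x \in S -> S = symd [fset x] (S `\ x) :> {fset L}.
  move=> xS; apply/fsetP => t; rewrite in_symd in_fset1 in_fsetD1.
  by have [->|] := eqVneq t x.
have [bU|bU] := eqVneq (coords a b) U.
  have [|x xU ->] := fset_pred subc cardc; first by rewrite -bU eq_sym.
  by exists x; [exact: UP|rewrite bU [in RHS](flip U x)// symdK].
have [cU|cU] := eqVneq (coords a c) U.
  have [x xU ->] := fset_pred subb cardb bU.
  by exists x; [exact: UP|rewrite cU; exact: flip].
have [x xU bE] := fset_pred subb cardb bU.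
have [x' xU' cE] := fset_pred subc cardc cU.
have [p [rp pU] _] := coords_unique ra UP.
exfalso; apply: (@no_triangle _ _ HS HE p b c) => //.
  have [|b' pb' b'E] := @coords_down a p x ra rp; first by rewrite pU.
  have [_ /eqP rb' _] := and3P pb'.
  by rewrite (coords_inj ra rb rb')// b'E pU.
have [|c' pc' c'E] := @coords_down a p x' ra rp; first by rewrite pU.
have [_ /eqP rc' _] := and3P pc'.
by rewrite (coords_inj ra rc rc')// c'E pU.
Qed.

Lemma coords_flip a b x : rank a = 1 -> rank b = 1 -> a <= x -> rank x = 2 ->
  exists2 c, adjacent b c & coords a c = symd [fset x] (coords a b).
Proof.
move=> ra rb ax rx; have [xb|xb] := boolP (x \in coords a b).
  have [c bc cE] := coords_down ra rb xb; exists c; rewrite // cE.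
  apply/fsetP => t; rewrite in_symd in_fset1 in_fsetD1.
  by have [->|] := eqVneq t x; rewrite ?xb.
have [t|c [rc cE] _] := @coords_unique a (x |` coords a b) ra.
  by rewrite in_fset1U => /predU1P[->//|/(coordsP ra)].
have xc : x \in coords a c by rewrite cE fset1U1.
have [b' cb' b'E] := coords_down ra rc xc; have [_ /eqP rb' _] := and3P cb'.
have bb' : b = b'.
  by apply: (coords_inj ra) => //; rewrite b'E cE fsetU1K.
exists c; first by rewrite bb' adjacent_sym.
rewrite cE; apply/fsetP => t; rewrite in_symd in_fset1 in_fset1U.
by have [->|] := eqVneq t x; rewrite ?(negbTE xb).
Qed.

(** With [b] as origin, [q] is the atom whose coordinates are the two edges [b]|[c] and [b]|[e]. *)
Lemma square b c e y : adjacent b c -> adjacent b e -> c != e -> c <= y ->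
  e <= y -> b <= y -> exists q, [/\ adjacent c q, adjacent e q, q <= y & q != b].
Proof.
move=> bc be ce cy ey by_.
have [[/eqP rb /eqP rc /eqP rbc] [_ /eqP re /eqP rbe]] := (and3P bc, and3P be).
have nbce : b `|` c != b `|` e.
  apply: contraNneq ce => eq; apply/eqP.
  by apply: (coords_inj rb rc re); rewrite !coords_adjacent_bot// eq.
have [s|q [rq qE] _] := @coords_unique b [fset b `|` c; b `|` e] rb.
  by rewrite in_fset2 => /orP[] /eqP ->; rewrite leUl.
have down s f : rank f = 1 -> s \in coords b q -> coords b f = coords b q `\ s ->
    adjacent f q.
  move=> rf sq fE; have [f' qf' f'E] := coords_down rb rq sq.
  have [_ /eqP rf' _] := and3P qf'.
  by rewrite (coords_inj rb rf rf') ?f'E// adjacent_sym.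
exists q; split.
- apply: (down (b `|` e)) => //; first by rewrite qE !inE eqxx orbT.
  rewrite coords_adjacent_bot// qE; apply/fsetP => t.
  rewrite in_fsetD1 !inE; have [->|] := eqVneq t (b `|` e); rewrite ?orbF//.
  by rewrite eq_sym (negbTE nbce).
- apply: (down (b `|` c)) => //; first by rewrite qE !inE eqxx.
  rewrite coords_adjacent_bot// qE; apply/fsetP => t.
  rewrite in_fsetD1 !inE; have [->|] := eqVneq t (b `|` c) => //=.
  exact/negbTE.
- rewrite -(coords_sub q rb by_) qE; apply/fsubsetP => s.
  rewrite in_fset2 in_level_atom// => /orP[] /eqP ->.
    by rewrite leUl leUx by_ cy rbc.
  by rewrite leUl leUx by_ ey rbe.
- apply: contraTneq (fset21 (b `|` c) (b `|` e)) => qb; rewrite -qE qb.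
  by rewrite /coords joinxx (level1_self HS) in_fset0.
Qed.

End Coordinates.

(** * Elements of the lattice as faces of the cube *)

Section Faces.
Context {d : Order.disp_t} {L : bLatticeType d}.
Context (HS : sheffer_poset L) (HE : eulerian L).
Context (C3 : @valency _ L 3 = 4).
Context (a : L) (ra : rank a = 1).
Implicit Types b c e x y z : L.
Implicit Types S D : {fset L}.
Let fin := sheffer_locally_finite HS.
Let gr := sheffer_graded HS.
Let rank_le := rank_le fin gr.
Let rank_bot := rank_bot fin gr.
Let coords_inja b c := coords_inj HS HE C3 (b := b) (c := c) ra.

Definition edges S := {in S, forall x, a <= x /\ rank x = 2}.

Lemma edges_coords b : edges (coords a b).
Proof. by move=> x; exact: coordsP. Qed.

(** For adjacent atoms a unique such [x] exists by [coords_adjacent]; [\bot] is the default when the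
    difference is not a singleton. *)
Definition direction b c : L :=
  xget \bot [set x | symd (coords a b) (coords a c) = [fset x]]%classic.

Lemma directionE b c x : coords a c = symd [fset x] (coords a b) ->
  direction b c = x.
Proof.
move=> cE; have E : symd (coords a b) (coords a c) = [fset x].
  by rewrite cE [symd [fset x] _]symdC symdK.
have : symd (coords a b) (coords a c) = [fset direction b c].
  exact: (@xgetPex L \bot [set t | symd (coords a b) (coords a c) = [fset t]]%classic
    (ex_intro _ x E)).
by rewrite E => /fset1_inj.
Qed.

Local Opaque direction.

Lemma directionP b c : adjacent b c ->
  (a <= direction b c /\ rank (direction b c) = 2) /\
  coords a c = symd [fset direction b c] (coords a b).
Proof.
by move=> /(coords_adjacent HS HE C3 ra)[x xP cE]; rewrite (directionE cE).
Qed.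

(** The free coordinates of the face [y], read off at its vertex [b]. *)
Definition directions y b : {fset L} := direction b @` neighbours \bot y b.

Lemma directionsP y b x : rank b = 1 ->
  reflect (exists2 c, (c <= y) && adjacent b c & coords a c = symd [fset x] (coords a b))
    (x \in directions y b).
Proof.
move=> rb; apply: (iffP (imfsetP _ _ _ _)) => /= [[c]|[c cy cE]].
  rewrite (mem_neighbours HS)// => cy ->; exists c => //.
  by case/andP: cy => _ /directionP[].
by exists c; rewrite ?(mem_neighbours HS)// (directionE cE).
Qed.

Lemma edges_directions y b : rank b = 1 -> edges (directions y b).
Proof.
move=> rb x /(directionsP _ _ rb)[c /andP[_ bc] cE].
by have [+ _] := directionP bc; rewrite (directionE cE).
Qed.

Lemma card_directions y b : rank b = 1 -> b <= y ->
  #|` directions y b| = (rank y).-1.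
Proof.
move=> rb by_; rewrite card_in_imfset; first exact: (card_neighbours_atom HS HE).
move=> c c'; rewrite !(mem_neighbours HS _ _ rb) => /andP[_ bc] /andP[_ bc'] cc'.
have [[_ cE] [_ c'E]] := (directionP bc, directionP bc').
have [_ /eqP rc _] := and3P bc; have [_ /eqP rc' _] := and3P bc'.
apply: (coords_inja rc rc'); rewrite cE c'E.
exact: (congr1 (fun x => symd [fset x] (coords a b)) cc').
Qed.

(* Opposite edges of a square have the same direction. *)
Lemma directions_step y b c : b <= y -> c <= y -> adjacent b c ->
  directions y c = directions y b.
Proof.
move=> by_ cy bc; have [/eqP rb /eqP rc _] := and3P bc.
apply/esym/eqP; rewrite eqEfcard !card_directions// leqnn andbT.
apply/fsubsetP => x /(directionsP _ _ rb)[e /andP[ey be] eE].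
have [/eqP re] : rank e == 1%N /\ true by case/and3P: be.
move=> _; apply/(directionsP _ _ rc).
have [_] := directionP bc; move: (direction b c) => u cE.
have [ec|ec] := eqVneq e c.
  exists b; first by rewrite by_ adjacent_sym.
  by rewrite -ec eE symdK.
have [|q [cq eq qy qb]] := square HS HE C3 bc be _ cy ey by_; first by rewrite eq_sym.
exists q; first by rewrite qy.
have [_] := directionP cq; move: (direction c q) => v qcE.
have [_] := directionP eq; move: (direction e q) => w qeE.
have [_ /eqP rq _] := and3P cq.
(* The path from [b] to [q] through [c] flips [u] and [v], the one through [e] flips [x] and [w]. If
   [x] is not [v], then [x = w], and [q] would equal [b]. *)
have inE := symd1_eq (etrans (etrans (congr1 (symd [fset v]) (esym cE)) (esym qcE))
  (etrans qeE (congr1 (symd [fset w]) eE))).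
have xu : x != u.
  apply: contraNneq ec => xu; apply/eqP/(coords_inja re rc).
  exact: (etrans eE (etrans (congr1 (fun x => symd [fset x] (coords a b)) xu) (esym cE))).
have [vx|vx] := eqVneq x v; first by rewrite vx; exact: qcE.
have := inE x; rewrite eqxx addbT (negbTE vx) (negbTE xu) => /esym/negbFE/eqP xw.
suff qb' : coords a q = coords a b by rewrite (coords_inja rq rb qb') eqxx in qb.
by rewrite qeE eE -xw symdK.
Qed.

Lemma vertex_exists S : edges S -> exists2 b, rank b = 1 & coords a b = S.
Proof. by move=> ES; have [b [rb bS] _] := coords_unique HS HE C3 ra ES; exists b. Qed.

(** Walk from [b] to [c] inside [y], flipping one differing coordinate at a time; the available
    directions never change. *)
Lemma directions_sub y b c : rank b = 1 -> rank c = 1 -> b <= y ->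
  symd (coords a b) (coords a c) `<=` directions y b -> c <= y.
Proof.
move=> + rc; move Dn : (symd (coords a b) (coords a c)) => D.
move Sn : #|` D| => n; elim: n => [|n IH] in b D Dn Sn * => rb by_ DS.
  by move: Dn; rewrite (cardfs0_eq Sn) => /symd_eq0/(coords_inja rb rc) <-.
have [x xD] : exists x, x \in D by apply/fset0Pn; rewrite -cardfs_gt0 Sn.
have /(directionsP _ _ rb)[e /andP[ey be] eE] := fsubsetP DS x xD.
have [_ /eqP re _] := and3P be.
apply: (IH e (D `\ x)) => //.
- by rewrite eE symdD1 Dn.
- by move: Sn; rewrite (cardfsD1 x) xD add1n => -[].
- rewrite (directions_step by_ ey be); apply: fsubset_trans DS.
  exact: fsubD1set.
Qed.

(** By [directions_sub] the subsets of [directions y b] give distinct atoms below [y], and their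
    number [2 ^ (rank y - 1)] is the number of all atoms below [y]. *)
Lemma mem_face y b c : rank b = 1 -> rank c = 1 -> b <= y ->
  (c <= y) = (symd (coords a b) (coords a c) `<=` directions y b).
Proof.
move=> rb rc by_; apply/idP/idP => [cy|]; last exact: directions_sub.
have vertex (S : {fset L}) : exists v, edges S -> rank v = 1 /\ coords a v = S.
  have [ES|ES] := pselect (edges S); last by exists a.
  by have [v rv vS] := vertex_exists ES; exists v.
have [v vP] := choice vertex.
have ED S : S `<=` directions y b -> edges (symd (coords a b) S).
  move=> /fsubsetP SD x; rewrite in_symd.
  case xb : (x \in coords a b); first by move=> _; exact: edges_coords xb.
  by rewrite addFb => /SD; exact: edges_directions.
have cl : c \in level \bot y 1 by rewrite (in_atoms_below HS) cy rc.
have [S] : exists2 S, S \in fpowerset (directions y b) &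
    c = v (symd (coords a b) S).
  apply: (@fset_inj_onto {fset L} L (fun S => v (symd (coords a b) S))
    (fpowerset (directions y b)) _ _ _ _ _ cl).
- move=> S; rewrite fpowersetE => SD; have [rv vE] := vP _ (ED S SD).
  rewrite (in_atoms_below HS) rv andbT.
  by apply: (directions_sub rb rv by_); rewrite vE symdK.
- move=> S S'; rewrite !fpowersetE => /ED/vP[_ vE] /ED/vP[_ vE'] vv.
  by rewrite -(symdK (coords a b) S) -vE vv vE' symdK.
- rewrite (card_atoms_below HS) card_fpowerset card_directions//.
  have ry : (0 < rank y)%N by rewrite (leq_trans _ (rank_le by_))// rb.
  by rewrite -(prednK ry) (valency_cube HS HE).
rewrite fpowersetE => SD cE; have [_ vE] := vP _ (ED S SD).
by rewrite cE vE symdK.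
Qed.

(** [y] is the element above [b] spanned by the edges from [b] to its neighbours [f x] in the
    directions [x] of [D]. *)
Lemma face_exists b D : rank b = 1 -> edges D ->
  exists2 y, b <= y & directions y b = D.
Proof.
move=> rb ED; have Db := boolean_above_atom HS HE rb.
have flip x : exists c, x \in D ->
    adjacent b c /\ coords a c = symd [fset x] (coords a b).
  have [/ED[ax rx]|] := boolP (x \in D); last by exists b.
  by have [c bc cE] := coords_flip HS HE C3 ra rb ax rx; exists c.
have [f fP] := choice flip.
have [s|y by_ yE] := boolean_level1_onto HS Db (S := (fun x => b `|` f x) @` D).
  move=> /imfsetP[x /= xD ->]; rewrite leUl rb; split=> //.
  by have [/and3P[_ _ /eqP]] := fP x xD.
exists y => //; apply/fsetP => x; apply/idP/idP => [/(directionsP _ _ rb)[c]|xD].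
  move=> /andP[cy bc] cE; have [_ /eqP rc /eqP rbc] := and3P bc.
  have : b `|` c \in level b y 1 by rewrite in_level_atom// leUl leUx by_ cy rbc.
  rewrite yE => /imfsetP[x' /= x'D bcE]; have [bf fE] := fP x' x'D.
  have [_ /eqP rf _] := and3P bf.
  have cf : coords b c = coords b (f x') by rewrite !(coords_adjacent_bot HS)// bcE.
  move: fE; rewrite -(coords_inj HS HE C3 rb rc rf cf) => fE.
  by rewrite -(directionE cE) (directionE fE).
have [bf fE] := fP x xD; apply/(directionsP _ _ rb); exists (f x) => //.
rewrite bf andbT (le_trans (leUr _ b))//.
have : b `|` f x \in level b y 1 by rewrite yE; apply/imfsetP; exists x.
by rewrite in_level_atom// => /and3P[].
Qed.

(** The number of atoms below an element determines its rank, since the values [0] and [2 ^ n] are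
    distinct. *)
Lemma atoms_below_le y z :
  (forall c, rank c = 1 -> c <= y -> c <= z) -> y <= z.
Proof.
move=> sub; apply: (level1_sub_le HS (p := \bot)); rewrite ?le0x//.
  move=> t _ ty; rewrite !(card_atoms_below HS); have := rank_le ty.
  have C n : @valency _ L n.+1 = (2 ^ n)%N := valency_cube HS HE n C3.
  move: (rank y) (rank t) => [|n] [|m] //=; rewrite ?(valency0 HS) !C => _ /eqP.
    by rewrite expn_eq0.
  by rewrite eqn_exp2l// => /eqP ->.
apply/fsubsetP => c; rewrite !(in_atoms_below HS) => /andP[cy /eqP rc].
by rewrite sub// rc.
Qed.

End Faces.

(** * The isomorphism with the infinite cubical lattice *)

Section CubicalLattice.
Context {d : Order.disp_t} {L : bLatticeType d}.
Context (HS : sheffer_poset L) (HE : eulerian L).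
Context (C3 : @valency _ L 3 = 4).
Context (a : L) (ra : rank a = 1).
Let X := rank2_above a.
Let fin := sheffer_locally_finite HS.
Let gr := sheffer_graded HS.
Implicit Types (f : X -> cube_coord) (S D E : {fset L}) (b c y z : L) (x : X).

(** The function [f] stands for a face of the cube, [CoordStar] marking the free coordinates; the
    compatible sets are its vertices. *)
Definition compatible f S := forall x,
  f x != CoordStar -> (val x \in S) = (f x == Coord1).

Let edge x : a <= val x /\ rank (val x) = 2.
Proof. by have := valP x; rewrite inE => -[rx /ltW]. Qed.

Let edges_val (A : {fset X}) : edges a (val @` A).
Proof. by move=> _ /imfsetP[x /= _ ->]; exact: edge. Qed.

Let edge_val t : a <= t -> rank t = 2 -> exists x, val x = t.
Proof.
move=> at_ rt; have tX : t \in X.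
  rewrite inE; split=> //; rewrite lt_neqAle at_ andbT.
  by apply: contra_eqN rt => /eqP <-; rewrite ra.
by exists (Sub t tX); rewrite SubK.
Qed.

Lemma compatibleP f S D E :
  (forall x, f x = if val x \in D then CoordStar
                   else if val x \in S then Coord1 else Coord0) ->
  edges a S -> edges a E ->
  symd S E `<=` D <-> compatible f E.
Proof.
move=> fE ES EE; split=> [/fsubsetP sub x|comp].
  have := sub (val x); rewrite fE in_symd.
  case: (val x \in D) => //.
  by case: (val x \in S); case: (val x \in E) => //= /(_ isT).
apply/fsubsetP => t tSE.
have [at_ rt] : a <= t /\ rank t = 2.
  move: tSE; rewrite in_symd; case tS : (t \in S); first by move=> _; exact: ES.
  by rewrite addFb => /EE.
have [x xt] := edge_val at_ rt; have := comp x; rewrite fE xt.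
move: tSE; rewrite in_symd; case: (t \in D) => //.
by case: (t \in S); case: (t \in E) => //= _ /(_ isT).
Qed.

Lemma cube_face_sets f : cube_face X f -> exists S D,
  [/\ edges a S, edges a D &
    forall x, f x = if val x \in D then CoordStar
                    else if val x \in S then Coord1 else Coord0].
Proof.
move=> [finD finS].
exists (val @` fset_set (f @^-1` [set Coord1])%classic).
exists (val @` fset_set (f @^-1` [set CoordStar])%classic).
split; try exact: edges_val.
move=> x; rewrite !(mem_imfset _ _ val_inj) !in_fset_set//.
have inP t : (x \in (f @^-1` [set t])%classic) = (f x == t).
  by apply/idP/eqP; rewrite inE.
by rewrite !inP; case: (f x).
Qed.

Lemma compatible_face f : cube_face X f -> exists2 y, y != \bot &
  forall c, rank c = 1 -> c <= y <-> compatible f (coords a c).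
Proof.
move=> /cube_face_sets[S [D [ES ED fE]]].
have [b rb bS] := vertex_exists HS HE C3 ra ES.
have [y by_ yD] := face_exists HS HE C3 ra rb ED.
exists y => [|c rc]; first exact: (neq_bot_le HS (rank1_neq_bot HS rb)).
rewrite (mem_face HS HE C3 ra rb rc by_) yD bS.
by apply: compatibleP => //; exact: edges_coords.
Qed.

(** Used to recover [f] from its vertices: each value allowed at [x] is attained, by correcting the
    base vertex [S] at [x] alone. *)
Lemma compatible_vertex f x (s : bool) : cube_face X f ->
  f x = CoordStar \/ (f x == Coord1) = s -> exists c,
  [/\ rank c = 1, compatible f (coords a c) & (val x \in coords a c) = s].
Proof.
move=> /cube_face_sets[S [D [ES ED fE]]] fxs.
pose T := if (val x \in S) == s then S else symd [fset val x] S.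
have ET : edges a T.
  rewrite /T; case: ifP => // _ t; rewrite in_symd in_fset1.
  by have [-> _|_] := eqVneq t (val x); [exact: edge|exact: ES].
have [c rc cT] := vertex_exists HS HE C3 ra ET.
exists c; rewrite cT; split=> //.
  apply/(compatibleP fE ES ET); rewrite /T; case: ifPn => [_|xs].
    by apply/fsubsetP => t; rewrite in_symd addbb.
  apply/fsubsetP => t; rewrite !in_symd in_fset1 addbC addbK => /eqP ->.
  move: fxs xs; rewrite fE; case: ifP => // _.
  by case: (val x \in S) => -[//|<-].
rewrite /T; case: ifPn => [/eqP//|].
by rewrite in_symd in_fset1 eqxx; case: (val x \in S); case: s {fxs T ET cT}.
Qed.

Lemma compatible_onto z : z != \bot -> exists f, cube_face X f /\
  forall c, rank c = 1 -> c <= z <-> compatible f (coords a c).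
Proof.
move=> z0; have [b [_ bz rb]] : exists b, [/\ \bot <= b, b <= z & rank b = 1].
  apply: (level_exists fin gr); rewrite ?le0x// (rank_bot fin gr).
  by rewrite (rank_gt0 fin gr).
pose D := directions a z b; pose S := coords a b.
pose f x := if val x \in D then CoordStar
            else if val x \in S then Coord1 else Coord0.
have finX E : finite_set [set x : X | val x \in E]%classic.
  apply: (@finite_preimage _ _ [set` E]%classic (fun x : X => val x)) => //.
  by move=> x y _ _; exact: val_inj.
exists f; split=> [|c rc].
  split; [apply: sub_finite_set (finX D)|apply: sub_finite_set (finX S)] => x /=;
    by rewrite /f; case: ifP => //; case: ifP.
rewrite (mem_face HS HE C3 ra rb rc bz); apply: compatibleP => //.
  exact: edges_coords.
exact: edges_coords.
Qed.

Lemma cubical_isomorphic :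
  poset_isomorphic (fun x y : L => (x <= y)%O) (@cubical_le X).
Proof.
have face (u : infinite_cubical_lattice X) : exists y, match u with
    | None => y = \bot
    | Some f => y != \bot /\
        forall c, rank c = 1 -> c <= y <-> compatible (val f) (coords a c)
    end.
  case: u => [f|]; last by exists \bot.
  have [|y y0 yP] := @compatible_face (val f); last by exists y.
  by have := valP f; rewrite inE.
have [h hP] := choice face.
apply: (@poset_isomorphic_surj _ _ _ _ h) => [[f|] [g|]|y|[f|] [g|]|z] //=.
- by move=> /le_anti/val_inj ->.
- have [[_ fP] [_ gP]] := (hP (Some f), hP (Some g)).
  have ff : cube_face X (val f) by have := valP f; rewrite inE.
  apply/idP/lefP => [fg x|fg].
    change (val f x <= val g x)%O.
    (* If [g] is fixed at [x], every vertex of [f] has the value of [g] there. A free [f x] would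
       allow both values, equating the two booleans. *)
    have key s c : rank c = 1 -> compatible (val f) (coords a c) ->
        (val x \in coords a c) = s ->
        val g x != CoordStar -> s = (val g x == Coord1).
      by move=> rc /(fP c rc) cf <-; apply: (gP c rc).1; exact: le_trans fg.
    case gx : (val g x == CoordStar).
      by rewrite /Order.le/= /cube_coord_le gx orbT.
    have {}key s : val f x = CoordStar \/ (val f x == Coord1) = s ->
        s = (val g x == Coord1).
      by move=> /(compatible_vertex ff)[c [rc cf cx]]; apply: key cx _; rewrite ?gx.
    case: (val f x) key => key.
    + by have := key false (or_intror erefl); case: (val g x) gx.
    + by have := key true (or_intror erefl); case: (val g x) gx.
    + have := key true (or_introl erefl); have := key false (or_introl erefl).
      by move=> <-.
  apply: (atoms_below_le HS HE C3 (z := h (Some g))) => c rc /(fP c rc) cf.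
  apply/(gP c rc) => x gx; have : (val f x <= val g x)%O := fg x.
  rewrite /Order.le/= /cube_coord_le (negbTE gx) orbF => /eqP e.
  have {}e : val f x = val g x := e.
  by rewrite -e; apply: cf; rewrite e.
- by have [f0 _] := hP (Some f); rewrite (hP None) lex0; exact/negbTE.
- by rewrite (hP None) le0x.
- by rewrite (hP None) le0x.
have [->|z0] := eqVneq z \bot; first by exists None; exact: (hP None).
have [f [ff fP]] := compatible_onto z0.
have fX : f \in cube_face X by rewrite inE.
exists (Some (Sub f fX : cube_face X)).
have [_ hf] := hP (Some (Sub f fX : cube_face X)).
apply/eqP; rewrite eq_le; apply/andP; split.
  by apply: (atoms_below_le HS HE C3) => c rc /(hf c rc) cf; apply/(fP c rc).
by apply: (atoms_below_le HS HE C3) => c rc /(fP c rc) cf; apply/(hf c rc).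
Qed.

End CubicalLattice.

Theorem theorem4p7 (d : Order.disp_t) (L : bLatticeType d)
    (HS : sheffer_poset L) (HE : eulerian L) :
  poset_isomorphic (fun x y : L => (x <= y)%O)
    (fun A B : {fset atoms L} => (A `<=` B)%fset) \/
  (forall a : L, atom a ->
    poset_isomorphic (fun x y : L => (x <= y)%O)
      (@cubical_le (rank2_above a))).
Proof.
have fin := sheffer_locally_finite HS; have gr := sheffer_graded HS.
have [C3|C3] := valency3 HS HE; [left|right => a /(atomP HS) ra].
  apply: (boolean_isomorphic HS) => x y _ xy.
  have [->|x0] := eqVneq x \bot; last exact: (card_level1_upper HS HE).
  rewrite (rank_bot fin gr) subn0 (card_atoms_below HS).
  case ry : (rank y) => [|n]; last exact: (valency_simplex HS HE).
  exact: (valency0 HS).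
exact: (cubical_isomorphic HS HE C3).
Qed.
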